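(* Let $K$ be a locally compact $\sigma$-compact division ring equipped with the norm $|\cdot|$, let $n\ge1$, and let the additive group $K^n$ be endowed with the invariant metric $\rho(x,y)=\max_{1\le i\le n}|x_i-y_i|$ and Haar measure $\mu_n$. Let $(A(u))_{u\in K^n}$ be a $\mu_n$-measurable family of invertible $n\times n$ matrices with entries from $K$, write $A(u)^{-1}=(a_{ij}(u))$, and let $$k(u)=\max_{1\le i\le n}\sum_{j=1}^n|a_{ij}(u)|.$$ If $\Phi\in L^1_{k^n}(K^n)$, then the Hausdorff operator $$(\mathcal{H}f)(x)=\int_{K^n}\Phi(u)f(A(u)(x))\,d\mu_n(u)$$ is bounded on the real Hardy space $H^1(K^n)$, and $$\|\mathcal{H}\|\le2^n\|\Phi\|_{L^1_{k^n}}.$$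
   Context: Examples of $K$ in mind are $\mathbb{R}$, $\mathbb{Q}_p$, and the quaternions. The kernel $\Phi$ is a locally integrable function on $K^n$; $\Phi\in L^1_{k^n}(K^n)$ means $\|\Phi\|_{L^1_{k^n}}:=\int_{K^n}|\Phi(u)|k(u)^n\,d\mu_n(u)<\infty$. $B(x,r)$ is the ball of radius $r$ around $x$ for $\rho$. An atom on $K^n$ is a function $a$ such that (i) the support of $a$ is contained in a ball $B(x,r)$; (ii) $\|a\|_\infty\le1/\mu_n(B(x,r))$; (iii) $\int_{K^n}a\,d\mu_n=0$. The real Hardy space $H^1(K^n)$ consists of the functions $f=\sum_j\lambda_ja_j$ with $a_j$ atoms and $\sum_j|\lambda_j|<\infty$; $\|f\|_{H^1}$ is the infimum of $\sum_j|\lambda_j|$ over all such representations. $\|\mathcal{H}\|$ is the operator norm on $H^1(K^n)$.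
   Formalization: The norm |.| is required to be the module of K, i.e. mu(aE)=|a|mu(E) for Haar measure mu on K, and multiplicative with the triangle inequality; this excludes the complex numbers and quaternions, where the stated bound fails for the usual norm (n=1, A(u)=1/c, |c|>2). *)

(* Defs.v *)
From HB Require Import structures.
From mathcomp Require Import all_boot all_order all_algebra.
From mathcomp Require Import all_classical all_reals all_analysis.

Set Implicit Arguments.
Unset Strict Implicit.
Unset Printing Implicit Defensive.
Import Order.TTheory GRing.Theory Num.Theory.
Import numFieldNormedType.Exports.

Local Open Scope classical_set_scope.
Local Open Scope ring_scope.

(* A division ring with a multiplicative real-valued norm; multiplication need
   not be commutative.  The norm is an operation of its own because the library
   joins its notation `|_| with ring structures only for numDomainType, whose
   members are commutative. *)
HB.mixin Record isNormedDivisionRing (R : realType) K of GRing.UnitRing K := {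
  dnorm : K -> R;
  dnorm_unit : forall x : K, x != 0 -> x \is a GRing.unit;
  dnorm_ge0 : forall x, 0 <= dnorm x;
  dnorm_eq0 : forall x, dnorm x = 0 <-> x = 0;
  dnormD : forall x y, dnorm (x + y) <= dnorm x + dnorm y;
  dnormM : forall x y, dnorm (x * y) = dnorm x * dnorm y
}.

#[short(type="normedDivisionRingType")]
HB.structure Definition NormedDivisionRing (R : realType) :=
  {K of GRing.UnitRing K & isNormedDivisionRing R K}.

Section norm_topology.
Context (R : realType) (K : normedDivisionRingType R).
Implicit Types (x y z : K) (e : R).

Lemma dnorm1 : dnorm (1 : K) = 1.
Proof.
have n1 : dnorm (1 : K) != 0.
  by apply/eqP => /dnorm_eq0 /eqP; rewrite oner_eq0.
by apply: (mulfI n1); rewrite -dnormM !mulr1.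
Qed.

Lemma dnormN x : dnorm (- x) = dnorm x.
Proof.
suff N1 : dnorm (-1 : K) = 1 by rewrite -mulN1r dnormM N1 mul1r.
apply/eqP; rewrite -sqrp_eq1 ?dnorm_ge0 //.
by rewrite expr2 -dnormM mulrNN mulr1 dnorm1.
Qed.

Definition dnorm_ball x e : set K := [set y | dnorm (x - y) < e].

Lemma dnorm_ball_center x e : 0 < e -> dnorm_ball x e x.
Proof. by move=> e0; rewrite /dnorm_ball/= subrr (dnorm_eq0 0).2. Qed.

Lemma dnorm_ball_sym x y e : dnorm_ball x e y -> dnorm_ball y e x.
Proof. by rewrite /dnorm_ball/= -opprB dnormN. Qed.

Lemma dnorm_ball_triangle x y z e1 e2 :
  dnorm_ball x e1 y -> dnorm_ball y e2 z -> dnorm_ball x (e1 + e2) z.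
Proof.
rewrite /dnorm_ball/= => xy yz; rewrite -(subrKA y).
exact: le_lt_trans (dnormD _ _) (ltrD xy yz).
Qed.

(* Balls, uniformity and topology of K are those of the metric |x - y|; vectors
   and matrices over K then get the product topology from the library. *)
HB.instance Definition _ := isPointed.Build K 0.
HB.instance Definition _ := hasNbhs.Build K (nbhs_ (entourage_ dnorm_ball)).
HB.instance Definition _ := Nbhs_isPseudoMetric.Build R K
  erefl dnorm_ball_center dnorm_ball_sym dnorm_ball_triangle erefl.

End norm_topology.

Notation borel T := (g_sigma_algebraType (@open T)).

Definition sigma_compact (T : topologicalType) :=
  exists2 F : nat -> set T, (forall i, compact (F i)) &
    \bigcup_i F i = [set: T].

(* Haar measure of the additive group (T, add).  Regularity is not required
   separately: it is automatic for locally compact sigma-compact metric groups. *)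
Definition haar_measure (R : realType) (T : ptopologicalType)
    (add : T -> T -> T) (mu : {measure set (borel T) -> \bar R}) : Prop :=
  [/\ forall (x : T) (E : set (borel T)), measurable E ->
        mu [set add x y | y in E] = mu E,
      forall C : set T, compact C -> (mu C < +oo)%E &
      forall U : set T, open U -> U !=set0 -> (0 < mu U)%E].
Arguments haar_measure {R} T add mu.

(* The norm is the canonical one of a locally compact division ring: its module
   function, i.e. the factor by which multiplication by a scales Haar measure
   (|.| on the reals, |p|_p = 1/p on the p-adic numbers).  The weight k^n relies
   on this normalization; the usual absolute value of the complex numbers or of
   Hamilton's quaternions does not satisfy it. *)
Definition norm_is_module (R : realType) (K : normedDivisionRingType R)
    (mu : {measure set (borel K) -> \bar R}) : Prop :=
  forall (a : K) (E : set (borel K)), a != 0 -> measurable E ->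
    mu [set a * x | x in (E : set K)] = ((dnorm a)%:E * mu E)%E.

Section ae.
Context d (T : measurableType d) (R : realType).
Variable mu : {measure set T -> \bar R}.

(* mu-measurable, i.e. measurable for the mu-completed sigma-algebra when the
   target is a second countable Borel space *)
Definition ae_measurable d' (U : measurableType d') (f : T -> U) : Prop :=
  exists2 g : T -> U, measurable_fun setT g & \forall x \ae mu, f x = g x.

Definition ae_integrable (f : T -> R) : Prop :=
  exists2 g : T -> R, mu.-integrable setT (EFin \o g) &
    \forall x \ae mu, f x = g x.

End ae.

Section hardy.
Context (R : realType) (K : normedDivisionRingType R) (n : nat).
Variable mu : {measure set (borel 'cV[K]_n) -> \bar R}.
Implicit Types (f : 'cV[K]_n -> R) (T : ('cV[K]_n -> R) -> 'cV[K]_n -> R).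

Definition rho (x y : 'cV[K]_n) : R :=
  \big[Num.max/0]_(i < n) dnorm (x i 0 - y i 0).

Definition rho_ball (x : 'cV[K]_n) (r : R) : set 'cV[K]_n :=
  [set y | rho x y < r].

(* Borel representatives suffice, as membership in the Hardy space below is
   up to almost everywhere equality.  In \bar R, (+oo)^-1 = 0. *)
Definition atom (a : 'cV[K]_n -> R) : Prop :=
  measurable_fun [set: borel 'cV[K]_n] a /\
  exists (x : 'cV[K]_n) (r : R), 0 < r /\
    [/\ [set y | a y != 0] `<=` rho_ball x r,
        (Lnorm mu +oo (EFin \o a) <= (mu (rho_ball x r))^-1)%E &
        (\int[mu]_y (a y)%:E = 0)%E].

(* As the L^1-norm of an atom is at most 1, the series converges absolutely in
   L^1 and almost everywhere, with the same sum. *)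
Definition atomic_decomposition (lam : nat -> R) (a : nat -> 'cV[K]_n -> R) f
    : Prop :=
  [/\ forall j, atom (a j),
      (\sum_(0 <= j <oo) `|lam j|%:E < +oo)%E &
      \forall x \ae mu, series (fun j => lam j * a j x) @ \oo --> f x].

Definition hardy1 : set ('cV[K]_n -> R) :=
  [set f | exists lam a, atomic_decomposition lam a f].

Definition hardy1_norm f : \bar R :=
  ereal_inf [set s | exists lam a, atomic_decomposition lam a f /\
                       s = (\sum_(0 <= j <oo) `|lam j|%:E)%E].

Definition hardy1_bound T : set R :=
  [set C | 0 <= C /\ forall f, hardy1 f ->
     hardy1 (T f) /\ (hardy1_norm (T f) <= C%:E * hardy1_norm f)%E].

Definition hardy1_bounded T : Prop := hardy1_bound T !=set0.

Definition hardy1_opnorm T : \bar R :=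
  ereal_inf [set C%:E | C in hardy1_bound T].

Definition locally_integrable_on_vectors (Phi : 'cV[K]_n -> R) : Prop :=
  ae_measurable mu (Phi : borel 'cV[K]_n -> R) /\
  forall C : set 'cV[K]_n, compact C -> (\int[mu]_(u in C) `|Phi u|%:E < +oo)%E.

(* maximal absolute row sum; the default value 0 is harmless for n > 0 *)
Definition row_sum_norm (M : 'M[K]_n) : R :=
  \big[Num.max/0]_(i < n) \sum_(j < n) dnorm (M i j).

(* the norm of L^1 with weight k^n *)
Definition weighted_L1_norm (k Phi : 'cV[K]_n -> R) : \bar R :=
  (\int[mu]_u (`|Phi u| * k u ^+ n)%:E)%E.

Definition hausdorff_operator (Phi : 'cV[K]_n -> R)
    (A : 'cV[K]_n -> 'M[K]_n) f : 'cV[K]_n -> R :=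
  fun x => \int[mu]_u (Phi u * f (A u *m x)).

End hardy.

(* Main.v *)
From HB Require Import structures.
From Pilot Require Import Defs.
From mathcomp Require Import all_boot all_order all_algebra.
From mathcomp Require Import all_classical all_reals all_analysis.
From mathcomp Require Import measurable_realfun.
From mathcomp Require Import ring lra.
Import Pilot.Defs.

(** Let a be an atom carried by a ball B of radius r, and write B(s) for a ball of
    radius s.  Then x |-> a (A(u) x) has mean zero, because A(u) changes Haar
    measure by a constant factor, and it is carried by A(u)^-1 B.  The point is
    that A(u)^-1 B lies in a ball of measure at most (2 k(u))^n mu(B).  Indeed
    there is a single scalar c with |c| <= 2 k(u) such that A(u)^-1 maps B(s) into
    B(|c| s) (dominating_scalar): either some |c| lies in [k(u), 2 k(u)], or the
    gap in the values of the norm forces the norm to be ultrametric, and the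
    largest entry of A(u)^-1 does.  As |.| is the module of K, multiplication by c
    scales mu by |c|^n (haar_rho_ball_scale); this passes from K to K^n through
    the uniqueness of Haar measure (haar_measure_unique).  So a (A(u) x) is
    (2 k(u))^n times an atom.

    It remains to integrate over u.  For f = sum_j lam_j a_j the function Hf is the
    integral of g (w, x) = Phi(u) lam_j a_j (A(u) x) over w = (u, j), where j is
    counted: an average of multiples of atoms.  No Bochner integral is needed to
    see that such an average lies in H^1 (averages_of_atoms).  Fix q > 1.  Countably
    many balls B_0, B_1, ... suffice to enclose every ball with a loss of at most a
    factor q in measure (countable_balls), so the set of all w can be cut into
    measurable blocks U_0, U_1, ... such that g (w, .) is carried by B_m for w in
    U_m, with mu(B_m) nearly minimal.  The integral of g (w, .) over U_m is then a
    multiple of an atom on B_m, and these multiples add up to at most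
    q^2 2^n ||Phi|| sum_j |lam_j|.  Let q tend to 1 and take the infimum over the
    decompositions of f. *)

Set Implicit Arguments.
Unset Strict Implicit.
Unset Printing Implicit Defensive.
Import Order.TTheory GRing.Theory Num.Theory.
Import numFieldNormedType.Exports.

Local Open Scope classical_set_scope.
Local Open Scope ring_scope.

(** * Norms on division rings *)

Section division_ring_norm.
Context (R : realType) (K : normedDivisionRingType R).
Implicit Types (a c w x y z : K).

Lemma dnorm0 : dnorm (0 : K) = 0.
Proof. exact: (dnorm_eq0 _).2. Qed.

Lemma dnorm_gt0 x : (0 < dnorm x) = (x != 0).
Proof.
rewrite lt_neqAle dnorm_ge0 andbT eq_sym; congr negb.
by apply/eqP/eqP => [/(dnorm_eq0 x).1|->] //; exact: dnorm0.
Qed.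

Lemma dnormX x i : dnorm (x ^+ i) = dnorm x ^+ i.
Proof.
elim: i => [|i IH]; first by rewrite !expr0 dnorm1.
by rewrite !exprS dnormM IH.
Qed.

Lemma dmulVr x : x != 0 -> x^-1 * x = 1.
Proof. by move=> x0; rewrite mulVr// dnorm_unit. Qed.

Lemma dmulrV x : x != 0 -> x * x^-1 = 1.
Proof. by move=> x0; rewrite mulrV// dnorm_unit. Qed.

Lemma dnormV x : dnorm x^-1 = (dnorm x)^-1.
Proof.
have [->|x0] := eqVneq x 0; first by rewrite invr0 dnorm0 invr0.
have dx0 : dnorm x != 0 by rewrite gt_eqF// dnorm_gt0.
by apply: (mulIf dx0); rewrite -dnormM dmulVr// dnorm1 mulVf.
Qed.

Lemma dnormB x y : dnorm (x - y) = dnorm (y - x).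
Proof. by rewrite -opprB dnormN. Qed.

Lemma dnorm_sum_le (I : finType) (s : R) (F : I -> K) :
  0 <= s -> (forall x y, dnorm x <= s -> dnorm y <= s -> dnorm (x + y) <= s) ->
  (forall i, dnorm (F i) <= s) -> dnorm (\sum_i F i) <= s.
Proof.
move=> s0 sD Fs; by elim/big_ind : _ => //; rewrite dnorm0.
Qed.

Lemma dnorm_sum (I : finType) (F : I -> K) :
  dnorm (\sum_i F i) <= \sum_i dnorm (F i).
Proof.
elim/big_ind2 : _ => //; first by rewrite dnorm0.
by move=> x1 x2 y1 y2 h1 h2; rewrite (le_trans (dnormD _ _))// lerD.
Qed.

(** With no norm in [t, 2t], the ball {|x| < t} is an additive group H, and the
    multipliers of H are exactly the a with |a| <= 1: any larger multiplier
    would have unbounded powers.  Multipliers are closed under addition. *)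
Lemma norm_gap_ultrametric (t : R) (c : K) : c != 0 -> dnorm c < t ->
  (forall b : K, t <= dnorm b -> 2 * t < dnorm b) ->
  forall s x y, dnorm x <= s -> dnorm y <= s -> dnorm (x + y) <= s.
Proof.
move=> c0 ct gap.
have addH x y : dnorm x < t -> dnorm y < t -> dnorm (x + y) < t.
  move=> xt yt; rewrite ltNge; apply/negP => /gap; apply/negP; rewrite -leNgt.
  by rewrite (le_trans (dnormD _ _))// mulr2n mulrDl mul1r lerD// ltW.
have unit_ball w : (forall x, dnorm x < t -> dnorm (w * x) < t) -> dnorm w <= 1.
  move=> wH; rewrite leNgt; apply/negP => w1.
  have powH i : dnorm (w ^+ i * c) < t.
    by elim: i => [|i IH]; rewrite ?expr0 ?mul1r// exprS -mulrA wH.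
  have cpos : 0 < dnorm c by rewrite dnorm_gt0.
  have [N tN] : exists N, t / dnorm c < dnorm w ^+ N.
    (* Bernoulli: |w|^N >= 1 + N (|w| - 1) *)
    have wd : 0 < dnorm w - 1 by rewrite subr_gt0.
    exists (Num.truncn (t / dnorm c / (dnorm w - 1))).+1.
    set N := _.+1.
    have : t / dnorm c / (dnorm w - 1) < N%:R by rewrite truncnS_gt.
    rewrite ltr_pdivrMr// => /lt_le_trans; apply.
    have : forall i, 1 + (dnorm w - 1) * i%:R <= dnorm w ^+ i.
      elim=> [|i IH]; first by rewrite mulr0 addr0 expr0.
      rewrite exprS (le_trans _ (ler_wpM2l _ IH))// ?dnorm_ge0//.
      rewrite -natr1.
      have := mulr_ge0 (sqr_ge0 (dnorm w - 1)) (ler0n R i).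
      lra.
    by move=> /(_ N); apply: le_trans; rewrite mulrC lerDr.
  move: (powH N); rewrite dnormM dnormX ltNge => /negP; apply.
  by rewrite -ler_pdivrMr// ltW.
have one_add z : dnorm z <= 1 -> dnorm (1 + z) <= 1.
  move=> z1; apply: (unit_ball (1 + z)) => x xt; rewrite mulrDl mul1r addH//.
  by rewrite dnormM (le_lt_trans _ xt)// ler_piMl ?dnorm_ge0.
suff main s x y : dnorm x <= s -> dnorm y <= s -> dnorm y <= dnorm x ->
    dnorm (x + y) <= s.
  move=> s x y xs ys; have [yx|/ltW xy] := leP (dnorm y) (dnorm x).
    exact: main.
  by rewrite addrC main.
move=> xs ys yx; have [x0|x0] := eqVneq x 0; first by rewrite x0 add0r.
rewrite (_ : x + y = x * (1 + x^-1 * y)); last first.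
  by rewrite mulrDr mulr1 mulrA dmulrV// mul1r.
rewrite dnormM (le_trans _ xs)// ler_piMr ?dnorm_ge0// one_add//.
by rewrite dnormM dnormV mulrC ler_pdivrMr ?dnorm_gt0// mul1r.
Qed.

Variable n : nat.
Implicit Types M : 'M[K]_n.

Lemma row_sum_norm_ge M i : \sum_(j < n) dnorm (M i j) <= row_sum_norm M.
Proof. by rewrite /row_sum_norm; exact: le_bigmax. Qed.

Lemma entry_le_row_sum_norm M i j : dnorm (M i j) <= row_sum_norm M.
Proof.
apply: le_trans (row_sum_norm_ge M i).
by rewrite (bigD1 j)//= lerDl sumr_ge0// => k _; exact: dnorm_ge0.
Qed.

Lemma row_sum_norm_ge0 M : 0 <= row_sum_norm M.
Proof. exact: bigmax_ge_id. Qed.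

(** The factor 2 leaves room for the values of the norm: the row sum norm k need
    not be one of them.  If some |c| lies in [k, 2k], the row sum estimate applies.
    Otherwise the norm is ultrametric and a largest entry of M takes the place
    of c. *)
Lemma dominating_scalar M : M != 0 -> exists2 c : K,
  c != 0 /\ dnorm c <= 2 * row_sum_norm M &
  forall r (y : 'cV[K]_n), (forall j, dnorm (y j 0) < r) ->
    forall i, dnorm ((M *m y) i 0) < dnorm c * r.
Proof.
move=> M0; have [i0 [j0 Mij0]] : exists i, exists j, M i j != 0.
  apply/not_existsP => h; move/eqP : M0; apply; apply/matrixP => i j.
  rewrite mxE; apply: contra_notP (h i) => /eqP Mij; by exists j.
set k := row_sum_norm M.
have k0 : 0 < k by rewrite (lt_le_trans _ (entry_le_row_sum_norm M i0 j0))// dnorm_gt0.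
have bound r (y : 'cV[K]_n) : (forall j, dnorm (y j 0) < r) ->
    exists2 s, 0 <= s < r & forall j, dnorm (y j 0) <= s.
  move=> yr; exists (\big[Num.max/0]_(j < n) dnorm (y j 0)); last first.
    by move=> j; apply: le_bigmax.
  apply/andP; split.
    exact: bigmax_ge_id.
  elim/big_ind : _ => //; last by move=> *; rewrite gt_max; apply/andP.
  by rewrite (le_lt_trans (dnorm_ge0 _) (yr i0)).
have [[c /andP[kc ck]]|noc] := pselect (exists c : K, k <= dnorm c <= 2 * k).
  exists c; first by split=> //; rewrite -dnorm_gt0 (lt_le_trans k0).
  move=> r y /bound[s /andP[s0 sr] ys] i; rewrite mxE.
  apply: le_lt_trans (dnorm_sum _) _.
  apply: (@le_lt_trans _ _ (k * s)); last first.
    by rewrite (le_lt_trans (ler_wpM2r s0 kc))// ltr_pM2l// (lt_le_trans k0).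
  apply: le_trans (ler_wpM2r s0 (row_sum_norm_ge M i)).
  by rewrite mulr_suml ler_sum// => j _; rewrite dnormM ler_wpM2l// dnorm_ge0.
have gap (b : K) : k <= dnorm b -> 2 * k < dnorm b.
  by move=> kb; rewrite ltNge; apply/negP => bk; apply: noc; exists b; rewrite kb.
have lt_k i j : dnorm (M i j) < k.
  rewrite ltNge; apply/negP => kM; apply: noc; exists (M i j); rewrite kM/=.
  by rewrite (le_trans (entry_le_row_sum_norm M i j))// ler_peMl ?ler1n// ltW.
have ultra := norm_gap_ultrametric Mij0 (lt_k i0 j0) gap.
pose m := [arg max_(ij > (i0, j0)) dnorm (M ij.1 ij.2)]%O.
have maxM i j : dnorm (M i j) <= dnorm (M m.1 m.2).
  by rewrite /m; case: Order.TotalTheory.arg_maxP => // ij _ /(_ (i, j)); exact.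
have m0 : 0 < dnorm (M m.1 m.2) by rewrite (lt_le_trans _ (maxM i0 j0))// dnorm_gt0.
exists (M m.1 m.2).
  by rewrite -dnorm_gt0 m0 (le_trans (ltW (lt_k _ _)))// ler_peMl ?ler1n// ltW.
move=> r y /bound[s /andP[s0 sr] ys] i; rewrite mxE.
apply: (@le_lt_trans _ _ (dnorm (M m.1 m.2) * s)); last by rewrite ltr_pM2l.
apply: dnorm_sum_le; first by rewrite mulr_ge0// ltW.
  exact: ultra.
by move=> j; rewrite dnormM ler_pM ?dnorm_ge0.
Qed.

End division_ring_norm.

(** * Topology and Borel sets of spaces of matrices *)

Section norm_topology_facts.
Context (R : realType) (K : normedDivisionRingType R).
Implicit Types (x y : K) (e : R).

Lemma nbhs_dnormP x (A : set K) :
  nbhs x A <-> exists2 e, 0 < e & forall y, dnorm (x - y) < e -> A y.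
Proof. by rewrite nbhs_ballP. Qed.

Lemma open_dnormP (U : set K) : open U <->
  forall x, U x -> exists2 e, 0 < e & forall y, dnorm (x - y) < e -> U y.
Proof.
rewrite openE; split => [oU x /oU/nbhs_dnormP//|oU x Ux].
exact/nbhs_dnormP/oU.
Qed.

Lemma hausdorff_division_ring : hausdorff_space K.
Proof.
rewrite ball_hausdorff => a b ab.
have ab0 : 0 < dnorm (a - b) / 2 by rewrite divr_gt0// dnorm_gt0 subr_eq0.
exists (PosNum ab0, PosNum ab0) => /=; apply/eqP; rewrite -subset0 => z [/= az bz].
suff : dnorm (a - b) < dnorm (a - b) by rewrite ltxx.
rewrite -{1}(subrKA z) (le_lt_trans (dnormD _ _))// (splitr (dnorm (a - b))).
have bz' : dnorm (b - z) < dnorm (a - b) / 2 by exact: bz.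
by apply: ltrD; [exact: az|rewrite (dnormB z)].
Qed.

Lemma nbhs_mxP m p (M : 'M[K]_(m, p)) (A : set 'M[K]_(m, p)) : nbhs M A <->
  exists2 e, 0 < e &
    forall N : 'M[K]_(m, p), (forall i j, dnorm (M i j - N i j) < e) -> A N.
Proof.
rewrite nbhs_ballP; split=> -[e /= e0 MA]; exists e => // N MN; apply: MA => //.
by case: MN.
Qed.

Lemma open_mxP m p (U : set 'M[K]_(m, p)) : open U <->
  forall M, U M -> exists2 e, 0 < e &
    forall N : 'M[K]_(m, p), (forall i j, dnorm (M i j - N i j) < e) -> U N.
Proof.
rewrite openE; split => [oU M /oU/nbhs_mxP//|oU M UM].
exact/nbhs_mxP/oU.
Qed.

Lemma open_dball x e : open [set y : K | dnorm (x - y) < e].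
Proof.
apply/open_dnormP => y /= xy; exists (e - dnorm (x - y)); first by rewrite subr_gt0.
move=> z yz; rewrite -(subrKA y) (le_lt_trans (dnormD _ _))//.
by rewrite -ltrBrDl.
Qed.

Lemma continuous_trmx m p : continuous (@trmx K m p).
Proof.
move=> M A /nbhs_mxP[e e0 MA]; apply/nbhs_mxP; exists e => // N MN.
by apply: MA => i j; rewrite !mxE.
Qed.

Lemma compact_cV_pi n (A : 'I_n -> set K) : (forall i, compact (A i)) ->
  compact [set v : 'cV[K]_n | forall i, A i (v i 0)].
Proof.
move=> cA; rewrite (_ : mkset _ = trmx @`
  [set v : 'rV[K]_n | forall i, A i (v ord0 i)]); last first.
  apply/seteqP; split => [v Av|_ [v Av <-] i]; last by rewrite mxE; exact: Av.
  by exists v^T; rewrite ?trmxK// => i; rewrite mxE; exact: Av.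
apply: continuous_compact; last exact: rV_compact.
exact/continuous_subspaceT/continuous_trmx.
Qed.

(** A scalar that dominates M on balls is a Lipschitz constant for it. *)
Lemma continuous_mulmx n (M : 'M[K]_n) : continuous (fun y : 'cV[K]_n => M *m y).
Proof.
have [->|M0] := eqVneq M 0.
  by under eq_fun do rewrite mul0mx; exact: cst_continuous.
have [c [c0 _] Mc] := dominating_scalar M0.
move=> y A /nbhs_mxP[e e0 yA]; apply/nbhs_mxP.
have c_gt0 : 0 < dnorm c by rewrite dnorm_gt0.
exists (e / dnorm c); first by rewrite divr_gt0.
move=> z yz; apply: yA => i j; rewrite ord1.
have := Mc _ (y - z) _ i; rewrite mulmxBr !mxE => Mcyz.
rewrite -[ltRHS](divfK (lt0r_neq0 c_gt0)) mulrC.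
by apply: Mcyz => k; rewrite !mxE.
Qed.

Lemma locally_compact_ball (lcK : locally_compact [set: K]) :
  exists2 e, 0 < e & exists C : set K, [/\ compact C, closed C &
    [set y | dnorm y < e] `<=` C].
Proof.
have [C + [cC clC]] := lcK 0 I.
rewrite withinET => /nbhs_dnormP[e e0 eC]; exists e => //.
by exists C; split=> // y ye; apply: eC; rewrite sub0r dnormN.
Qed.

Lemma closed_cV_pi n (A : 'I_n -> set K) : (forall i, closed (A i)) ->
  closed [set v : 'cV[K]_n | forall i, A i (v i 0)].
Proof.
move=> cA; rewrite -openC; apply/open_mxP => v /=.
move=> /existsNP[i Avi]; have := cA i; rewrite -openC => /open_dnormP.
move=> /(_ _ Avi)[e e0 eA]; exists e => // w vw /(_ i).
exact/eA/vw.
Qed.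

Lemma open_cV_pi n (A : 'I_n -> set K) : (forall i, open (A i)) ->
  open [set v : 'cV[K]_n | forall i, A i (v i 0)].
Proof.
move=> oA; rewrite openE => v Av.
have near_i i : nbhs v [set w : 'cV[K]_n | A i (w i 0)].
  have [e e0 eA] := (open_dnormP _).1 (oA i) _ (Av i).
  by apply/nbhs_mxP; exists e => // w vw; exact/eA/vw.
exact: filter_forall near_i.
Qed.

Lemma sigma_compact_dense (scK : sigma_compact K) :
  exists d : nat -> K, forall x e, 0 < e -> exists i, dnorm (x - d i) < e.
Proof.
have [F cF FT] := scK.
have net i k : exists s : seq K, forall x, F i x ->
    exists2 y, y \in s & dnorm (y - x) < k.+1%:R^-1.
  have := cF i; rewrite compact_cover.
  move=> /(_ K setT (fun y => [set x | dnorm (y - x) < k.+1%:R^-1])).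
  case=> [y _|x _|D _ FD].
  - exact: open_dball.
  - by exists x => //=; rewrite subrr dnorm0.
  - by exists (finmap.enum_fset D) => x /FD[y /= yD xy]; exists y.
pose s i k := sval (cid (net i k)).
exists (fun m => if unpickle m is Some (i, k, j) then nth 0 (s i k) j else 0).
move=> x e e0; have [i _ Fx] : (\bigcup_i F i) x by rewrite FT.
have [k ke] : exists k, k.+1%:R^-1 < e.
  exists (Num.truncn e^-1); rewrite invf_plt ?posrE//; exact: truncnS_gt.
have [y ys yx] := svalP (cid (net i k)) x Fx.
exists (pickle (i, k, index y (s i k))).
by rewrite pickleK nth_index// dnormB (lt_trans yx).
Qed.

(** Matrices of natural numbers are countable and index the matrices with entries
    in the dense sequence. *)
Lemma dense_mx (d : nat -> K) :
  (forall x e, 0 < e -> exists i, dnorm (x - d i) < e) ->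
  forall m p, exists D : nat -> 'M[K]_(m, p),
  forall M e, 0 < e -> exists k, forall i j, dnorm (M i j - D k i j) < e.
Proof.
move=> dd m p.
exists (fun k => if unpickle k is Some N then map_mx d (N : 'M[nat]_(m, p)) else 0).
move=> M e e0; have h i j : exists k, dnorm (M i j - d k) < e by exact: dd.
exists (pickle (\matrix_(i, j) sval (cid (h i j)))) => i j.
by rewrite pickleK !mxE; exact: (svalP (cid (h i j))).
Qed.

End norm_topology_facts.

Section borel_sets.
Context (R : realType) (K : normedDivisionRingType R).
Variable d : nat -> K.
Hypothesis dd : forall x e, 0 < e -> exists i, dnorm (x - d i) < e.

Lemma open_borel (T : ptopologicalType) (U : set T) :
  open U -> measurable (U : set (borel T)).
Proof. exact: sub_sigma_algebra. Qed.

Lemma closed_borel (T : ptopologicalType) (U : set T) :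
  closed U -> measurable (U : set (borel T)).
Proof.
by move=> cU; rewrite -[U]setCK; apply: measurableC; exact: open_borel (closed_openC cU).
Qed.

Lemma continuous_borel (T U : ptopologicalType) (f : T -> U) :
  continuous f -> measurable_fun [set: borel T] (f : borel T -> borel U).
Proof.
move=> /continuousP cf; apply: (@measurability _ _ (borel T) (borel U) setT f (@open U)) => //.
move=> _ [V oV <-]; rewrite setTI; exact: open_borel (cf _ oV).
Qed.

Section into_borel.
Context disp (X : measurableType disp).

Lemma measurable_dball (f : X -> K) x e :
  measurable_fun setT (f : X -> borel K) ->
  measurable [set t | dnorm (x - f t) < e].
Proof.
move=> mf; rewrite -[X in measurable X]setTI.
exact: mf measurableT _ (open_borel (@open_dball _ _ _ _)).
Qed.

(** A second countable target has measurable boxes as a countable base, so a map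
    into matrices is measurable as soon as its entries are. *)
Lemma measurable_mx m p (f : X -> 'M[K]_(m, p)) :
  (forall i j, measurable_fun setT ((fun t => f t i j) : X -> borel K)) ->
  measurable_fun setT (f : X -> borel 'M[K]_(m, p)).
Proof.
move=> mf; apply: (@measurability _ _ X (borel 'M[K]_(m, p)) setT f (@open _)) => //.
move=> _ [U oU <-]; rewrite setTI.
have [D DD] := dense_mx dd m p.
pose box k N := [set M : 'M[K]_(m, p) | forall i j,
  dnorm (D k i j - M i j) < N.+1%:R^-1].
rewrite (_ : _ @^-1` _ = \bigcup_(kN in [set: nat * nat])
  (if `[< box kN.1 kN.2 `<=` U >] then f @^-1` box kN.1 kN.2 else set0)).
  apply: countable_bigcupT_measurable => [|[k N]]; first exact: countableP.
  case: asboolP => // _.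
  rewrite (_ : _ @^-1` _ = \bigcap_(ij in [set: 'I_m * 'I_p])
      [set t | dnorm (D k ij.1 ij.2 - f t ij.1 ij.2) < N.+1%:R^-1]).
    apply: fin_bigcap_measurable => [|[i j] _]; first exact: finite_finset.
    exact: measurable_dball.
  by apply/seteqP; split => [t ft [i j] _|t ft i j]; [exact: ft|exact: (ft (i, j))].
apply/seteqP; split => [t Uft|t [[k N] _]]; last first.
  by case: asboolP => // boxU; exact: boxU.
have [e e0 eU] := (open_mxP _).1 oU _ Uft.
have [N Ne] : exists N, N.+1%:R^-1 < e / 2.
  exists (Num.truncn (e / 2)^-1).
  by rewrite invf_plt ?posrE ?divr_gt0//; exact: truncnS_gt.
have [k kN] := DD (f t) N.+1%:R^-1 ltac:(by rewrite invr_gt0).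
exists (k, N) => //=; case: asboolP => [_ i j|]; first by rewrite dnormB.
case=> M MD; apply: eU => i j; rewrite -(subrKA (D k i j)).
rewrite (le_lt_trans (dnormD _ _))// (splitr e) ltrD// (lt_trans _ Ne)//.
Qed.

(** Continuity is stated in metric form, at the points of the product: an open set
    of pairs is a countable union of products of balls with centers d i. *)
Lemma measurable_binop (op : K -> K -> K) (f g : X -> K) :
  (forall x y e, 0 < e -> exists2 r, 0 < r & forall x' y',
     dnorm (x - x') < r -> dnorm (y - y') < r -> dnorm (op x y - op x' y') < e) ->
  measurable_fun setT (f : X -> borel K) ->
  measurable_fun setT (g : X -> borel K) ->
  measurable_fun setT ((fun t => op (f t) (g t)) : X -> borel K).
Proof.
move=> cop mf mg; apply: (@measurability _ _ X (borel K) setT _ (@open K)) => //.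
move=> _ [U oU <-]; rewrite setTI.
pose box k l N := [set xy : K * K |
  dnorm (d k - xy.1) < N.+1%:R^-1 /\ dnorm (d l - xy.2) < N.+1%:R^-1].
pose good (q : nat * nat * nat) :=
  box q.1.1 q.1.2 q.2 `<=` [set xy | U (op xy.1 xy.2)].
rewrite (_ : _ @^-1` _ = \bigcup_(q in [set: nat * nat * nat])
  (if `[< good q >] then
     [set t | dnorm (d q.1.1 - f t) < q.2.+1%:R^-1] `&`
     [set t | dnorm (d q.1.2 - g t) < q.2.+1%:R^-1] else set0)).
  apply: countable_bigcupT_measurable => [|[[k l] N]]; first exact: countableP.
  by case: asboolP => // _; apply: measurableI; exact: measurable_dball.
apply/seteqP; split => [t Ut|t [[[k l] N] _]]; last first.
  by case: asboolP => // gd [tf tg]; exact: (gd (f t, g t)).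
have [e e0 eU] := (open_dnormP _).1 oU _ Ut.
have [r r0 opr] := cop (f t) (g t) e e0.
have [N Ne] : exists N, N.+1%:R^-1 < r / 2.
  exists (Num.truncn (r / 2)^-1).
  by rewrite invf_plt ?posrE ?divr_gt0//; exact: truncnS_gt.
have N0 : 0 < N.+1%:R^-1 :> R by rewrite invr_gt0.
have [k kN] := dd (f t) N0; have [l lN] := dd (g t) N0.
exists ((k, l), N) => //=; case: asboolP => [_|].
  by split; rewrite /= dnormB.
have close (z w z' : K) : dnorm (z - w) < N.+1%:R^-1 ->
    dnorm (w - z') < N.+1%:R^-1 -> dnorm (z - z') < r.
  move=> zw wz'; rewrite -(subrKA w) (le_lt_trans (dnormD _ _))//.
  by rewrite (splitr r) ltrD// (lt_trans _ Ne).
by case=> -[x y] [/= kx ly]; apply: eU; apply: opr; [exact: close kx|exact: close ly].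
Qed.

Lemma measurable_dadd (f g : X -> K) :
  measurable_fun setT (f : X -> borel K) ->
  measurable_fun setT (g : X -> borel K) ->
  measurable_fun setT ((fun t => f t + g t) : X -> borel K).
Proof.
apply: measurable_binop => x y e e0; exists (e / 2); first by rewrite divr_gt0.
move=> x' y' xx' yy'; rewrite opprD addrACA (le_lt_trans (dnormD _ _))//.
by rewrite (splitr e) ltrD.
Qed.

Lemma measurable_dmul (f g : X -> K) :
  measurable_fun setT (f : X -> borel K) ->
  measurable_fun setT (g : X -> borel K) ->
  measurable_fun setT ((fun t => f t * g t) : X -> borel K).
Proof.
apply: measurable_binop => x y e e0.
pose c := dnorm x + dnorm y + 1.
have c1 : 1 <= c by rewrite /c lerDr addr_ge0 ?dnorm_ge0.
have c0 : 0 < c by rewrite (lt_le_trans _ c1).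
exists (Num.min 1 (e / (2 * c))).
  by rewrite lt_min ltr01/= divr_gt0// mulr_gt0.
move=> x' y'; rewrite !lt_min => /andP[xx1 xx] /andP[_ yy].
rewrite (_ : x * y - x' * y' = (x - x') * y + x' * (y - y')); last first.
  by rewrite mulrBl mulrBr subrKA.
have x'c : dnorm x' <= c.
  rewrite -(subrK x x') (le_trans (dnormD _ _))// dnormB /c.
  by have := dnorm_ge0 y; lra.
have yc : dnorm y <= c.
  by rewrite /c; have := dnorm_ge0 x; lra.
rewrite (le_lt_trans (dnormD _ _))// !dnormM.
have -> : e = e / (2 * c) * c + c * (e / (2 * c)).
  by rewrite invfM; field; rewrite gt_eqF.
apply: ltr_leD.
  apply: (@le_lt_trans _ _ (dnorm (x - x') * c)).
    by rewrite ler_wpM2l ?dnorm_ge0.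
  by rewrite ltr_pM2r.
by rewrite ler_pM ?dnorm_ge0// ltW.
Qed.

Lemma measurable_entry m p (f : X -> 'M[K]_(m, p)) i j :
  measurable_fun setT (f : X -> borel 'M[K]_(m, p)) ->
  measurable_fun setT ((fun t => f t i j) : X -> borel K).
Proof.
move=> mf; pose ev := (fun M => M i j) : borel 'M[K]_(m, p) -> borel K.
have mev : measurable_fun setT ev.
  apply: continuous_borel => M A /nbhs_dnormP[e e0 MA].
  by apply/nbhs_mxP; exists e => // N MN; exact/MA/MN.
exact: (measurableT_comp mev mf).
Qed.

Lemma measurable_mxadd m p (f g : X -> 'M[K]_(m, p)) :
  measurable_fun setT (f : X -> borel 'M[K]_(m, p)) ->
  measurable_fun setT (g : X -> borel 'M[K]_(m, p)) ->
  measurable_fun setT ((fun t => f t + g t) : X -> borel 'M[K]_(m, p)).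
Proof.
move=> mf mg; apply: measurable_mx => i j; under eq_fun do rewrite mxE.
by apply: measurable_dadd; exact: measurable_entry.
Qed.

Lemma measurable_mulmx m p q (f : X -> 'M[K]_(m, p)) (g : X -> 'M[K]_(p, q)) :
  measurable_fun setT (f : X -> borel 'M[K]_(m, p)) ->
  measurable_fun setT (g : X -> borel 'M[K]_(p, q)) ->
  measurable_fun setT ((fun t => f t *m g t) : X -> borel 'M[K]_(m, q)).
Proof.
move=> mf mg; apply: measurable_mx => i j; under eq_fun do rewrite mxE.
elim: (index_enum _) => [|k s IH].
  by under eq_fun do rewrite big_nil; exact: measurable_cst.
under eq_fun do rewrite big_cons.
by apply: measurable_dadd IH; apply: measurable_dmul; exact: measurable_entry.
Qed.

End into_borel.
End borel_sets.

(** * Uniqueness of Haar measure *)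

Section sigma_finite_packing.
Context d (T : measurableType d) (R : realType).

(** An alias of mu that carries a proof of sigma-finiteness, from which the
    bundled structure in Fubini's theorem is inferred. *)
Definition sigma_finite_of (mu : {measure set T -> \bar R})
  (_ : sigma_finite setT mu) : set T -> \bar R := mu.

Context (mu : {measure set T -> \bar R}) (h : sigma_finite setT mu).
HB.instance Definition _ := Measure.on (sigma_finite_of h).
HB.instance Definition _ :=
  Measure_isSigmaFinite.Build _ _ _ (sigma_finite_of h) h.
End sigma_finite_packing.

Lemma ex_sigma_finite_measure d (T : measurableType d) (R : realType)
    (mu : {measure set T -> \bar R}) : sigma_finite setT mu ->
  exists m : {sigma_finite_measure set T -> \bar R},
    (m : {measure set T -> \bar R}) = mu.
Proof.
by move=> h; exists (sigma_finite_of h); move: (h); case: mu {h} => m [c1 c2].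
Qed.

Lemma ex_pushforward d d' (T : measurableType d) (U : measurableType d')
    (R : realType) (mu : {measure set T -> \bar R}) (f : T -> U) :
  measurable_fun setT f ->
  exists nu : {measure set U -> \bar R}, forall E, nu E = mu (f @^-1` E).
Proof. by move=> mf; unshelve eexists (pushforward mu f). Qed.

Section invariant_measures.
Local Open Scope ereal_scope.

Lemma measure_sections_swap d1 d2 (T1 : measurableType d1)
    (T2 : measurableType d2) (R : realType)
    (m1 : {sigma_finite_measure set T1 -> \bar R})
    (m2 : {sigma_finite_measure set T2 -> \bar R}) (W : set (T1 * T2)) :
  measurable W ->
  \int[m1]_x m2 [set y | W (x, y)] = \int[m2]_y m1 [set x | W (x, y)].
Proof.
move=> mW; have := indic_fubini_tonelli m1 m2 mW.
rewrite indic_fubini_tonelli_FE// indic_fubini_tonelli_GE//= => h.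
transitivity (\int[m1]_x (m2 \o xsection W) x).
  by apply: eq_integral => x _ /=; rewrite xsectionE.
by rewrite h; apply: eq_integral => x _ /=; rewrite ysectionE.
Qed.

Context d (T : measurableType d) (R : realType).
Variables (add : T -> T -> T) (opp : T -> T) (zero : T).
Hypotheses (addA : associative add) (addC : commutative add)
  (add0 : left_id zero add) (addN : left_inverse zero opp add).
Hypothesis measurable_add :
  measurable_fun setT (fun p : T * T => add p.1 p.2).
Hypothesis measurable_opp : measurable_fun setT opp.

Let addKN x : cancel (add x) (add (opp x)).
Proof. by move=> y; rewrite addA addN add0. Qed.

Let addNK x : cancel (add (opp x)) (add x).
Proof. by move=> y; rewrite addA [add x _]addC addN add0. Qed.

Let image_add x (E : set T) : [set add x y | y in E] = add (opp x) @^-1` E.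
Proof.
apply/seteqP; split => [_ [y Ey <-]|y Ey] /=; first by rewrite addKN.
by exists (add (opp x) y) => //; exact: addNK.
Qed.

Let preimage_add x (E : set T) : add x @^-1` E = [set add (opp x) y | y in E].
Proof.
apply/seteqP; split => [y Ey|_ [y Ey <-]] /=; last by rewrite addNK.
by exists (add x y); [|exact: addKN].
Qed.

Let measurable_addl x : measurable_fun setT (add x).
Proof.
rewrite (_ : add x = (fun p => add p.1 p.2) \o (fun y => (x, y)))//.
by apply: measurableT_comp => //; exact: pair1_measurable.
Qed.

Lemma sigma_finite_translates (mu : {measure set T -> \bar R}) (B : set T)
    (D : nat -> T) :
  (forall x (E : set T), measurable E -> mu [set add x y | y in E] = mu E) ->
  measurable B -> mu B < +oo ->
  (forall x, exists i, B (add (opp (D i)) x)) -> sigma_finite setT mu.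
Proof.
move=> inv mB Boo cover; exists (fun i => [set add (D i) y | y in B]).
  apply/seteqP; split => // x _; have [i Bi] := cover x.
  by exists i => //; exists (add (opp (D i)) x) => //; exact: addNK.
move=> i; rewrite inv//; split=> //; rewrite image_add.
by rewrite -[X in measurable X]setTI; exact: measurable_addl.
Qed.

(** Evaluate the product measure of {(x, y) | x + y in E, y in B} by slicing in
    both directions: the y-slices are translates of E, and after translating by x
    the x-slices become {z in E | z - x in B}, whose own slices are translates
    of B.  Comparing an arbitrary E with one fixed B makes mu and nu proportional. *)
Lemma invariant_measure_unique (mu nu : {sigma_finite_measure set T -> \bar R})
    (B E : set T) :
  (forall x (E : set T), measurable E -> mu [set add x y | y in E] = mu E) ->
  (forall x (E : set T), measurable E -> nu [set add x y | y in E] = nu E) ->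
  measurable B -> (forall x, B x -> B (opp x)) -> measurable E ->
  mu E * nu B = nu E * mu B.
Proof.
move=> inv_mu inv_nu mB Bopp mE.
have preimT (S : set T) (f : T * T -> T) : measurable_fun setT f ->
    measurable S -> measurable (f @^-1` S).
  by move=> mf mS; rewrite -[X in measurable X]setTI; exact: mf.
have const_slice (nu' : {measure set T -> \bar R}) (S : set T) (r : \bar R) :
    measurable S ->
    \int[nu']_y (if y \in S then r else 0) = r * nu' S.
  move=> mS; rewrite -integral_cst// [RHS]integral_mkcond.
  by apply: eq_integral => y _; rewrite patchE.
pose W := [set p : T * T | E (add p.1 p.2) /\ B p.2].
have mW : measurable W.
  by apply: measurableI; [exact: (preimT E _ measurable_add)|exact: (preimT B snd measurable_snd)].
have -> : mu E * nu B = \int[nu]_y mu [set x | W (x, y)].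
  rewrite -(const_slice nu)//; apply: eq_integral => y _.
  case: ifPn => [|] yB.
    rewrite (_ : mkset _ = add y @^-1` E); first by rewrite preimage_add inv_mu.
    apply/seteqP; split => [x [/= Exy _]|x Ex]; rewrite /preimage /=.
      by rewrite addC.
    by split; [rewrite /= addC|exact: set_mem].
  rewrite (_ : mkset _ = set0) ?measure0//; apply/seteqP; split => // x [_ /=].
  by move/mem_set; rewrite (negbTE yB).
rewrite -measure_sections_swap//.
have oppB x z : B (add (opp x) z) = B (add (opp z) x).
  have e u v : opp (add (opp u) v) = add (opp v) u.
    have h : add (add (opp u) v) (add (opp v) u) = zero.
      by rewrite -addA addNK addN.
    by rewrite -[RHS](addKN (add (opp u) v)) h [RHS]addC add0.
  by apply/propext; split => /Bopp; rewrite e.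
pose V := [set p : T * T | E p.2 /\ B (add (opp p.2) p.1)].
have mV : measurable V.
  apply: measurableI; first exact: (preimT E snd measurable_snd).
  apply: (preimT B (fun p => add (opp p.2) p.1)) => //.
  rewrite (_ : (fun _ => _) = (fun p => add p.1 p.2) \o
    (fun p : T * T => (opp p.2, p.1)))//.
  apply: measurableT_comp => //; apply: measurable_fun_pair => //.
  exact: measurableT_comp.
transitivity (\int[mu]_x nu [set y | V (x, y)]).
  apply: eq_integral => x _.
  rewrite -(inv_nu x); last first.
    rewrite (_ : mkset _ = (fun y => (x, y)) @^-1` W)//.
    by rewrite -[X in measurable X]setTI; exact: pair1_measurable.
  congr (nu _); rewrite image_add; apply/seteqP; split => y.
    by move=> [/=]; rewrite addNK => Ey; rewrite oppB.
  by move=> [/= Ey]; rewrite -oppB => By; split => //=; rewrite addNK.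
rewrite measure_sections_swap// muleC -(const_slice nu)//.
apply: eq_integral => y _; case: ifPn => yE.
  rewrite (_ : mkset _ = [set add y x | x in B]) ?inv_mu//.
  rewrite image_add.
  apply/seteqP; split => [x []//|x Bx]; split => //; exact: set_mem.
rewrite (_ : mkset _ = set0) ?measure0//; apply/seteqP; split => // x [/=].
by move/mem_set; rewrite (negbTE yE).
Qed.
End invariant_measures.

Section haar_uniqueness.
Context (R : realType) (T : ptopologicalType).
Variables (add : T -> T -> T) (opp : T -> T) (zero : T).
Hypotheses (addA : associative add) (addC : commutative add)
  (add0 : left_id zero add) (addN : left_inverse zero opp add).
Hypothesis measurable_add : measurable_fun setT
  ((fun p => add p.1 p.2) : (borel T * borel T)%type -> borel T).
Hypothesis measurable_opp : measurable_fun setT (opp : borel T -> borel T).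
Variables (B C : set T) (D : nat -> T).
Hypotheses (oB : open B) (B0 : B zero) (Bopp : forall x, B x -> B (opp x)).
Hypotheses (cC : compact C) (clC : closed C) (BC : B `<=` C).
Hypothesis cover : forall x, exists i, B (add (opp (D i)) x).
Implicit Types mu nu : {measure set (borel T) -> \bar R}.

Let mB : measurable (B : set (borel T)). Proof. exact: open_borel. Qed.

Lemma haar_small_set mu : haar_measure T add mu -> (0 < mu B < +oo)%E.
Proof.
move=> [inv fin pos]; apply/andP; split; first by apply: pos => //; exists zero.
have mC : measurable (C : set (borel T)) by exact: closed_borel.
by apply: le_lt_trans (fin _ cC); rewrite le_measure ?inE.
Qed.

Lemma haar_sigma_finite mu : haar_measure T add mu -> sigma_finite setT mu.
Proof.
move=> hmu; have /andP[_ Boo] := haar_small_set hmu; have [inv _ _] := hmu.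
exact: (@sigma_finite_translates _ (borel T) R add opp zero addA addC add0 addN
  measurable_add mu B D).
Qed.

(** B is a symmetric neighbourhood of zero inside a compact set, so both measures
    of B are positive and finite, and their ratio is the constant. *)
Lemma haar_measure_unique mu nu :
  haar_measure T add mu -> haar_measure T add nu ->
  exists2 c : R, 0 < c &
    forall E : set (borel T), measurable E -> nu E = (c%:E * mu E)%E.
Proof.
move=> hmu hnu; have /andP[mu0 muoo] := haar_small_set hmu.
have /andP[nu0 nuoo] := haar_small_set hnu.
have [m em] := ex_sigma_finite_measure (haar_sigma_finite hmu).
have [n' en] := ex_sigma_finite_measure (haar_sigma_finite hnu).
have {}em F : m F = mu F by rewrite -em.
have {}en F : n' F = nu F by rewrite -en.
have mu_fin : mu B \is a fin_num by rewrite ge0_fin_numE.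
have nu_fin : nu B \is a fin_num by rewrite ge0_fin_numE.
have mub0 : 0 < fine (mu B) by rewrite fine_gt0// mu0.
exists (fine (nu B) / fine (mu B)); first by rewrite divr_gt0// fine_gt0// nu0.
move=> E mE.
have [inv_mu _ _] := hmu; have [inv_nu _ _] := hnu.
have h : (mu E * nu B = nu E * mu B)%E.
  rewrite -!em -!en; apply: (@invariant_measure_unique _ (borel T) R add opp zero
    addA addC add0 addN measurable_add measurable_opp m n' B E) => //.
  - by move=> x F mF; rewrite !em inv_mu.
  - by move=> x F mF; rewrite !en inv_nu.
rewrite EFinM fineK// -muleA [(_^-1%:E * _)%E]muleC muleA [(nu B * _)%E]muleC h.
by rewrite -muleA -{1}(fineK mu_fin) -EFinM divff ?mule1// gt_eqF.
Qed.

End haar_uniqueness.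

Section haar_on_vectors.
Context (R : realType) (K : normedDivisionRingType R).
Hypotheses (lcK : locally_compact [set: K]) (scK : sigma_compact K).

Lemma haarK_unique (mu nu : {measure set (borel K) -> \bar R}) :
  haar_measure K +%R mu -> haar_measure K +%R nu ->
  exists2 c : R, 0 < c &
    forall E : set (borel K), measurable E -> nu E = (c%:E * mu E)%E.
Proof.
have [e e0 [C [cC clC eC]]] := locally_compact_ball lcK.
have [d dd] := sigma_compact_dense scK.
apply: (@haar_measure_unique R K +%R -%R 0 _ _ _ _ _ _
  [set y : K | dnorm y < e] C d) => //.
- exact: addrA.
- exact: addrC.
- exact: add0r.
- exact: addNr.
- by apply: (measurable_dadd dd); [exact: measurable_fst|exact: measurable_snd].
- apply: continuous_borel => x A /nbhs_dnormP[r r0 xA].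
  apply/nbhs_dnormP; exists r => // y xy; apply: xA.
  by rewrite -opprD dnormN.
- rewrite (_ : mkset _ = [set y | dnorm (0 - y) < e]); first exact: open_dball.
  by apply/seteqP; split => y /=; rewrite sub0r dnormN.
- by rewrite /= dnorm0.
- by move=> x /=; rewrite dnormN.
- move=> x; have [i di] := dd x e e0; exists i => /=.
  by rewrite addrC.
Qed.

Variable n : nat.
Local Notation V := 'cV[K]_n.
Implicit Types mu nu : {measure set (borel V) -> \bar R}.

(** In K^n the small set of the uniqueness theorem is a product of balls, inside
    the corresponding product of compact sets. *)
Lemma haarV_setup : exists e (B C : set V) (D : nat -> V),
  [/\ 0 < e, B = [set v : V | forall i, dnorm (v i 0) < e] &
  [/\ open B, compact C, closed C, B `<=` C &
      forall x, exists i, B (- D i + x)]].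
Proof.
have [e e0 [C [cC clC eC]]] := locally_compact_ball lcK.
have [d dd] := sigma_compact_dense scK.
have [D DD] := dense_mx dd n 1.
exists e, [set v : V | forall i, dnorm (v i 0) < e].
exists [set v : V | forall i, C (v i 0)], D; split=> //; split.
- apply: (@open_cV_pi _ _ _ (fun=> [set y | dnorm y < e])) => _.
  rewrite (_ : mkset _ = [set y | dnorm (0 - y) < e]); first exact: open_dball.
  by apply/seteqP; split => y /=; rewrite sub0r dnormN.
- exact: (compact_cV_pi (fun=> cC)).
- exact: (closed_cV_pi (fun=> clC)).
- by move=> v ve i; apply: eC; exact: ve.
- move=> x; have [k Dk] := DD x e e0; exists k => i /=.
  by rewrite !mxE addrC; exact: Dk.
Qed.

Let measurable_addV : measurable_fun setT
  ((fun p => p.1 + p.2) : (borel V * borel V)%type -> borel V).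
Proof.
have [d dd] := sigma_compact_dense scK.
by apply: (measurable_mxadd dd); [exact: measurable_fst|exact: measurable_snd].
Qed.

Let measurable_oppV : measurable_fun setT ((fun v => - v) : borel V -> borel V).
Proof.
apply: continuous_borel => x A /nbhs_mxP[r r0 xA].
apply/nbhs_mxP; exists r => // y xy; apply: xA => i j.
by rewrite !mxE -opprD dnormN; exact: xy.
Qed.

Lemma haarV_unique mu nu : haar_measure V +%R mu -> haar_measure V +%R nu ->
  exists2 c : R, 0 < c &
    forall E : set (borel V), measurable E -> nu E = (c%:E * mu E)%E.
Proof.
have [e [B [C [D [e0 BE [oB cC clC BC cover]]]]]] := haarV_setup.
apply: (@haar_measure_unique R V +%R -%R 0 _ _ _ _ _ _ B C D) => //.
- exact: addrA.
- exact: addrC.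
- exact: add0r.
- exact: addNr.
- by rewrite BE => i; rewrite mxE dnorm0.
- by rewrite BE => x xe i; rewrite mxE dnormN; exact: xe.
Qed.

Lemma haarV_sigma_finite mu : haar_measure V +%R mu -> sigma_finite setT mu.
Proof.
have [e [B [C [D [e0 BE [oB cC clC BC cover]]]]]] := haarV_setup.
apply: (@haar_sigma_finite R V +%R -%R 0 _ _ _ _ _ B C D) => //.
- exact: addrA.
- exact: addrC.
- exact: add0r.
- exact: addNr.
- by rewrite BE => i; rewrite mxE dnorm0.
Qed.

Lemma measurable_mulmxl (M : 'M[K]_n) :
  measurable_fun setT ((fun v => M *m v) : borel V -> borel V).
Proof. by apply: continuous_borel; exact: continuous_mulmx. Qed.

(** The image of mu under M is again a Haar measure. *)
Lemma haar_mulmx mu (M N : 'M[K]_n) : haar_measure V +%R mu ->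
  M *m N = 1%:M -> N *m M = 1%:M ->
  exists2 c : R, 0 < c & forall E : set (borel V), measurable E ->
    mu ((fun v : V => M *m v) @^-1` E) = (c%:E * mu E)%E.
Proof.
move=> hmu MN NM; have [inv fin pos] := hmu.
have [nu nuE] := ex_pushforward mu (measurable_mulmxl M).
have MNK (v : V) : M *m (N *m v) = v by rewrite mulmxA MN mul1mx.
have NMK (v : V) : N *m (M *m v) = v by rewrite mulmxA NM mul1mx.
suff hnu : haar_measure V +%R nu.
  have [c c0 cE] := haarV_unique hmu hnu.
  by exists c => // E mE; rewrite -cE// nuE.
split.
- move=> x E mE; rewrite !nuE -[RHS](inv (N *m x)); last first.
    by rewrite -[X in measurable X]setTI; exact: measurable_mulmxl.
  congr (mu _); apply/seteqP; split => [v /= [w Ew xw]|_ [v /= Ev <-]] /=.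
    exists (N *m w); rewrite ?MNK// -mulmxDr.
    by rewrite xw NMK.
  by exists (M *m v) => //; rewrite mulmxDr MNK.
- move=> E cE; rewrite nuE; apply: fin.
  rewrite (_ : _ @^-1` _ = (fun v : V => N *m v) @` E); last first.
    apply/seteqP; split => [v /= Ev|_ [v Ev <-]]; last by rewrite /= MNK.
    by exists (M *m v).
  by apply: continuous_compact => //; exact/continuous_subspaceT/continuous_mulmx.
- move=> U oU [v Uv]; rewrite nuE; apply: pos.
    by move/continuousP : (@continuous_mulmx _ _ _ M); exact.
  by exists (N *m v); rewrite /= MNK.
Qed.

End haar_on_vectors.

(** * Haar measure of balls *)

Section balls.
Context (R : realType) (K : normedDivisionRingType R) (n : nat).
Local Notation V := 'cV[K]_n.
Implicit Types (x y : V) (r : R).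

Lemma rho_ballP x r y :
  rho_ball x r y <-> 0 < r /\ forall i, dnorm (x i 0 - y i 0) < r.
Proof.
rewrite /rho_ball /rho /=; split => [xyr|[r0 xyr]]; last first.
  by elim/big_ind : _ => // u v ur vr; rewrite gt_max ur.
split; first by apply: le_lt_trans xyr; exact: bigmax_ge_id.
by move=> i; apply: le_lt_trans xyr; exact: le_bigmax.
Qed.

Lemma open_rho_ball x r : open (rho_ball x r).
Proof.
apply/open_mxP => y /rho_ballP[r0 xy].
exists (r - rho x y).
  rewrite subr_gt0 /rho; elim/big_ind : _ => // u v ur vr; by rewrite gt_max ur.
move=> z yz; apply/rho_ballP; split => // i.
rewrite -(subrKA (y i 0)) (le_lt_trans (dnormD _ _))// addrC -ltrBrDr.
by rewrite (lt_le_trans (yz i 0))// lerB// /rho; exact: le_bigmax.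
Qed.

Lemma measurable_rho_ball x r : measurable (rho_ball x r : set (borel V)).
Proof. exact: open_borel (@open_rho_ball x r). Qed.

Lemma rho_ball_center x r : 0 < r -> rho_ball x r x.
Proof. by move=> r0; apply/rho_ballP; split => // i; rewrite subrr dnorm0. Qed.

Lemma le_rho_ball x y r s t : rho x y < s -> r + s <= t ->
  rho_ball x r `<=` rho_ball y t.
Proof.
move=> xys rst z /rho_ballP[r0 xz]; have /rho_ballP[s0 xy] : rho_ball x s y by [].
apply/rho_ballP; split; first by rewrite (lt_le_trans _ rst)// addr_gt0.
move=> i; rewrite -(subrKA (x i 0)) (le_lt_trans (dnormD _ _))//.
by rewrite (lt_le_trans _ rst)// addrC ltrD// dnormB.
Qed.

Hypotheses (lcK : locally_compact [set: K]) (scK : sigma_compact K).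
Variable mu : {measure set (borel V) -> \bar R}.
Hypothesis hmu : haar_measure V +%R mu.

Lemma haar_rho_ball_gt0 x r : 0 < r -> (0 < mu (rho_ball x r))%E.
Proof.
move=> r0; have [_ _ pos] := hmu; apply: pos; first exact: open_rho_ball.
by exists x; exact: rho_ball_center.
Qed.

Lemma haar_rho_ball_translate x r : mu (rho_ball x r) = mu (rho_ball 0 r).
Proof.
have [inv _ _] := hmu; rewrite -(inv x (rho_ball 0 r)); last exact: measurable_rho_ball.
congr (mu _); apply/seteqP; split => [y /rho_ballP[r0 xy]|_ [y /rho_ballP[r0 y0] <-]].
  exists (y - x); last by rewrite subrKC.
  apply/rho_ballP; split=> // i; have := xy i.
  by rewrite !mxE sub0r opprB.
apply/rho_ballP; split => // i; have := y0 i.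
by rewrite !mxE sub0r opprD addrA subrr sub0r.
Qed.

Variable muK : {measure set (borel K) -> \bar R}.
Hypotheses (haarK : haar_measure K +%R muK) (normK : norm_is_module muK).

Definition scale_coord (i : 'I_n) (c : K) : 'M[K]_n :=
  diag_mx (\row_j (if j == i then c else 1)).

Lemma scale_coordE i c x j :
  (scale_coord i c *m x) j 0 = (if j == i then c * x j 0 else x j 0).
Proof. by rewrite mul_diag_mx !mxE; case: eqP => // _; rewrite mul1r. Qed.

Lemma scale_coordV i c d : c * d = 1 -> scale_coord i c *m scale_coord i d = 1%:M.
Proof.
move=> cd; rewrite /scale_coord mulmx_diag -diag_const_mx; congr diag_mx.
by apply/rowP => j; rewrite !mxE; case: eqP => // _; rewrite mulr1.
Qed.

(** Restrict mu to a small tube around the i-th axis and project it on that axis: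
    the image is a Haar measure of K, hence proportional to muK, for which the
    scaling factor is the norm by hypothesis. *)
Lemma haar_scale_coord i c (E : set (borel V)) : c != 0 -> measurable E ->
  mu ((fun v : V => scale_coord i c *m v) @^-1` E) = (((dnorm c)^-1)%:E * mu E)%E.
Proof.
move=> c0 mE; have [inv fin pos] := hmu.
have [e0 e_gt0 [C [cC clC eC]]] := locally_compact_ball lcK.
have c_gt0 : 0 < dnorm c by rewrite dnorm_gt0.
have [m m_gt0 mulE] := haar_mulmx lcK scK hmu (scale_coordV i (dmulrV c0))
  (scale_coordV i (dmulVr c0)).
rewrite mulE//; congr (_%:E * _)%E.
pose tube := [set v : V | forall j, j != i -> dnorm (v j 0) < e0].
have oB : open [set z : K | dnorm z < e0].
  rewrite (_ : mkset _ = [set y | dnorm (0 - y) < e0]); first exact: open_dball.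
  by apply/seteqP; split => y /=; rewrite sub0r dnormN.
have openif (U : set K) : open U ->
    open [set v : V | forall j, (if j == i then U else [set z | dnorm z < e0]) (v j 0)].
  by move=> oU; apply: (@open_cV_pi _ _ _
    (fun j => if j == i then U else [set z | dnorm z < e0])) => j; case: eqP.
have splitif (U : set K) : [set v : V | forall j,
      (if j == i then U else [set z | dnorm z < e0]) (v j 0)] =
    [set v : V | U (v i 0)] `&` tube.
  apply/seteqP; split => [v Uv|v [Uv tv] j]; last by case: (eqVneq j i) => [->|/tv].
  by split=> [|j /negbTE ji]; [have := Uv i; rewrite eqxx|have := Uv j; rewrite ji].
have otube : open tube.
  by have := openif _ openT; rewrite splitif setTI.
have mtube : measurable (tube : set (borel V)) by exact: open_borel.
have mcoord : measurable_fun setT ((fun v => v i 0) : borel V -> borel K).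
  exact: measurable_entry.
have [nu nuE] := ex_pushforward (mrestr mu mtube) mcoord.
have nuE' S : nu S = mu ([set v : V | S (v i 0)] `&` tube) by exact: nuE.
have hnu : haar_measure K +%R nu.
  split.
  - move=> z S mS; rewrite !nuE' -[RHS](inv (\col_j (if j == i then z else 0))); last first.
      by apply: measurableI => //; rewrite -[X in measurable X]setTI; exact: mcoord.
    congr (mu _); apply/seteqP; split.
      move=> v [/= [s Ss zs] tv].
      exists (v - \col_j (if j == i then z else 0)); last by rewrite subrKC.
      split=> [|j ji] /=; first by rewrite !mxE eqxx -zs addrC addKr.
      by rewrite !mxE (negbTE ji) subr0 tv.
    move=> _ [v [/= Sv tv] <-]; split=> [|j ji].
      by exists (v i 0); rewrite // !mxE eqxx.
    by rewrite !mxE (negbTE ji) add0r tv.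
  - move=> S cS; rewrite nuE'.
    pose box := [set v : V | forall j, (if j == i then S else C) (v j 0)].
    have clS : closed S.
      apply: compact_closed cS; exact: hausdorff_division_ring.
    have cbox : compact box by apply: (@compact_cV_pi _ _ _
      (fun j => if j == i then S else C)) => j; case: eqP.
    have clbox : closed box by apply: (@closed_cV_pi _ _ _
      (fun j => if j == i then S else C)) => j; case: eqP.
    apply: le_lt_trans (fin _ cbox); apply: le_measure; rewrite ?inE.
    + apply: measurableI => //; rewrite -[X in measurable X]setTI; apply: mcoord => //.
      exact: closed_borel.
    + exact: closed_borel.
    + by move=> v [/= Sv tv] j; case: (eqVneq j i) => [->//|ji]; exact/eC/tv.
  - move=> U oU [z Uz]; rewrite nuE'; apply: pos.
      by rewrite -splitif; exact: openif.
    exists (\col_j (if j == i then z else 0)); split=> [|j ji] /=.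
      by rewrite mxE eqxx.
    by rewrite mxE (negbTE ji) dnorm0.
have [t t_gt0 nut] := haarK_unique lcK scK haarK hnu.
pose B := [set z : K | dnorm z < e0].
have mB : measurable (B : set (borel K)) by exact: open_borel.
pose box := [set v : V | B (v i 0)] `&` tube.
have obox : open box by rewrite /box -splitif; exact: openif.
have mbox : measurable (box : set (borel V)) by exact: open_borel.
have mubox : (0 < mu box < +oo)%E.
  apply/andP; split.
    apply: pos => //; exists 0.
    by split=> [|j _]; rewrite /B /= mxE dnorm0.
  have clC' : closed [set v : V | forall j : 'I_n, C (v j 0)].
    exact: (closed_cV_pi (fun=> clC)).
  apply: le_lt_trans (fin _ (compact_cV_pi (fun=> cC))).
  apply: le_measure; rewrite ?inE//; first exact: closed_borel.
  by move=> v [/= Sv tv] j; apply: eC; case: (eqVneq j i) => [->//|/tv].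
have mubox_fin : mu box \is a fin_num by rewrite ge0_fin_numE//; case/andP: mubox.
have cB : muK ((fun z => c * z) @^-1` B) = (((dnorm c)^-1)%:E * muK B)%E.
  rewrite -dnormV -normK//; last first.
    by rewrite -dnorm_gt0 dnormV invr_gt0.
  congr (muK _); apply/seteqP; split => [z Bz|_ [z Bz <-]] /=.
    by exists (c * z) => //; rewrite mulrA dmulVr// mul1r.
  by rewrite mulrA dmulrV// mul1r.
have : (m%:E * mu box = ((dnorm c)^-1)%:E * mu box)%E.
  rewrite -mulE// (_ : _ @^-1` _ = [set v : V | (( *%R c) @^-1` B) (v i 0)] `&` tube).
    rewrite -nuE' nut; last first.
      rewrite -[X in measurable X]setTI; have [d dd] := sigma_compact_dense scK.
      by apply: (measurable_dmul dd) => //; exact: measurable_cst.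
    by rewrite cB muleCA -nut// nuE'.
  apply/seteqP; split => v [/= Bv tv]; (split=> [|j ji] /=; [|]).
  - by move: Bv; rewrite /= scale_coordE eqxx.
  - by have := tv j ji; rewrite scale_coordE (negbTE ji).
  - by rewrite /= scale_coordE eqxx.
  - by rewrite scale_coordE (negbTE ji); exact: tv.
rewrite -(fineK mubox_fin) -!EFinM => -[]; apply: mulIf.
by rewrite gt_eqF// fine_gt0.
Qed.

(** Scale the coordinates one after the other: the first k coordinates of box k are
    already cut down from |c| r to r. *)
Lemma haar_rho_ball_scale x r (c : K) : c != 0 -> 0 < r ->
  mu (rho_ball x (dnorm c * r)) = ((dnorm c ^+ n)%:E * mu (rho_ball x r))%E.
Proof.
move=> c0 r0; rewrite !(haar_rho_ball_translate x).
have c_gt0 : 0 < dnorm c by rewrite dnorm_gt0.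
pose B s := [set z : K | dnorm z < s].
have oB s : open (B s).
  rewrite (_ : B s = [set z | dnorm (0 - z) < s]); first exact: open_dball.
  by apply/seteqP; split => z; rewrite /B /= sub0r dnormN.
pose side k j := if (j < k)%N then r else dnorm c * r.
pose box k := [set v : V | forall j : 'I_n, B (side k j) (v j 0)].
have mbox k : measurable (box k : set (borel V)).
  by apply: open_borel; apply: (@open_cV_pi _ _ _ (fun j : 'I_n => B (side k j))).
have boxE k s : 0 < s -> (forall j : 'I_n, side k j = s) -> box k = rho_ball 0 s.
  move=> s0 ks; apply/seteqP; split => [v bv|v /rho_ballP[_ v0] j].
    apply/rho_ballP; split=> // j; rewrite mxE sub0r dnormN.
    by have := bv j; rewrite ks.
  by have := v0 j; rewrite mxE sub0r dnormN ks.
have step k : (k < n)%N -> mu (box k.+1) = (((dnorm c)^-1)%:E * mu (box k))%E.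
  move=> kn; rewrite -(haar_scale_coord (Ordinal kn) c0 (mbox k)); congr (mu _).
  suff e (v : V) (j : 'I_n) : B (side k.+1 j) (v j 0) <->
      B (side k j) ((scale_coord (Ordinal kn) c *m v) j 0).
    by apply/seteqP; split => v bv j; exact/e/bv.
  rewrite scale_coordE /side ltnS leq_eqVlt.
  have [->|jk] := eqVneq j (Ordinal kn).
    by rewrite eqxx/= ltnn /B/= dnormM ltr_pM2l.
  by rewrite (_ : (nat_of_ord j == k) = false)//; apply/negbTE.
have iter k : (k <= n)%N -> mu (box k) = ((dnorm c ^- k)%:E * mu (box 0%N))%E.
  elim: k => [_|k IH kn]; first by rewrite expr0 invr1 mul1e.
  by rewrite step// IH 1?ltnW// muleA -EFinM exprS invfM.
have := iter n (leqnn n).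
rewrite (boxE n r)// => [|j]; last by rewrite /side ltn_ord.
rewrite (boxE 0%N (dnorm c * r)) ?mulr_gt0// => ->.
by rewrite muleA -EFinM mulfV ?mul1e// expf_neq0// gt_eqF.
Qed.

(** Centers run through a dense sequence and radii through the rationals.  Room
    to perturb x and r comes from one of two sources: either norms close to 1
    exist, and enlarging r by such a factor changes the measure little; or no
    norm is close to r from below, and small changes of x and r do not change
    the ball at all. *)
Lemma countable_balls : exists (z : nat -> V) (s : nat -> R),
  (forall m, 0 < s m) /\
  forall x r q, 0 < r -> 1 < q ->
    exists2 m, rho_ball x r `<=` rho_ball (z m) (s m) &
      (mu (rho_ball (z m) (s m)) <= q%:E * mu (rho_ball x r))%E.
Proof.
have [d dd] := sigma_compact_dense scK; have [D DD] := dense_mx dd n 1.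
pose rad (t : rat) : R := if 0 < ratr t :> R then ratr t else 1.
exists (fun m => if (unpickle m : option (nat * rat)) is Some (i, t)
  then D i else 0).
exists (fun m => if (unpickle m : option (nat * rat)) is Some (i, t)
  then rad t else 1).
split=> [m|x r q r0 q1].
  by case: (unpickle m) => [[i t]|//]; rewrite /rad; case: ifPn.
suff [a [b [a0 ab abP]]] : exists a b, [/\ 0 <= a, a < b & forall s, a < s < b ->
    (mu (rho_ball x s) <= q%:E * mu (rho_ball x r))%E /\
    exists2 e, 0 < e & forall y, rho x y < e -> rho_ball x r `<=` rho_ball y s].
  have [t /andP[at_ tb]] : exists t : rat, a < ratr t < b.
    have [t] := rat_in_itvoo ab; rewrite in_itv/= => tab; by exists t.
  have [muq [e e0 xe]] := abP (ratr t) ltac:(by rewrite at_ tb).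
  have [i Di] := DD x e e0.
  exists (pickle (i, t)); rewrite pickleK /rad (le_lt_trans a0 at_).
    apply: xe; have /rho_ballP : 0 < e /\ forall i0, dnorm (x i0 0 - D i i0 0) < e.
      by split.
    by [].
  by rewrite haar_rho_ball_translate -(haar_rho_ball_translate x).
have q0 : 0 < q by rewrite (lt_trans ltr01).
have muge0 s : (0 <= mu (rho_ball x s))%E by exact: measure_ge0.
have [[c [c1 cq]]|noc] := pselect (exists c : K, 1 < dnorm c /\ dnorm c ^+ n <= q).
  have c0 : c != 0 by rewrite -dnorm_gt0 (lt_trans ltr01).
  exists r, (dnorm c * r); split; [exact: ltW|by rewrite ltr_pMl|].
  move=> s /andP[rs sc]; split.
    apply: (@le_trans _ _ (mu (rho_ball x (dnorm c * r)))).
      apply: le_measure; rewrite ?inE; try exact: measurable_rho_ball.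
      by move=> y; rewrite /rho_ball /= => /lt_trans; exact.
    by rewrite haar_rho_ball_scale// lee_wpmul2r// lee_fin.
  exists (s - r); first by rewrite subr_gt0.
  by move=> y xy; apply: le_rho_ball xy _; rewrite subrKC.
have [[v [v0 vr gap]]|nogap] := pselect (exists v, [/\ 0 <= v, v < r &
    forall z : K, dnorm z < r -> dnorm z <= v]).
  exists v, r; split=> // s /andP[vs sr]; split.
    apply: (@le_trans _ _ (mu (rho_ball x r))).
      apply: le_measure; rewrite ?inE; try exact: measurable_rho_ball.
      by move=> y; rewrite /rho_ball /= => /lt_trans; exact.
    by rewrite lee_pemull// lee_fin ltW.
  exists (s - v); first by rewrite subr_gt0.
  move=> y xy w /rho_ballP[_ xw].
  have /rho_ballP[_ yx] : rho_ball x (s - v) y by [].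
  apply/rho_ballP; split=> [|i]; first exact: le_lt_trans v0 vs.
  have xwv : dnorm (x i 0 - w i 0) <= v by apply: gap; exact: xw.
  rewrite -(subrKA (x i 0)) (le_lt_trans (dnormD _ _))// -(subrK v s).
  by rewrite ltr_leD// dnormB.
have above v : 0 <= v -> v < r -> exists2 z : K, v < dnorm z & dnorm z < r.
  move=> v0 vr; apply: contrapT => noz; apply: nogap; exists v; split=> // z zr.
  by rewrite leNgt; apply/negP => vz; apply: noz; exists z.
pose eta := q `^ n.+1%:R^-1.
have etaq : eta ^+ n.+1 = q.
  by rewrite -powR_mulrn ?powR_ge0// -powRrM mulVf ?pnatr_eq0// powRr1// ltW.
have eta1 : 1 < eta by rewrite -(expr_gt1 (ltn0Sn n)) ?powR_ge0// etaq.
have eta0 : 0 < eta by rewrite (lt_trans ltr01).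
have [z1 etaz1 z1r] : exists2 z : K, r / eta < dnorm z & dnorm z < r.
  apply: above; first by rewrite divr_ge0 ?ltW.
  by rewrite ltr_pdivrMr// ltr_pMr.
have [z2 z12 z2r] := above _ (dnorm_ge0 z1) z1r.
have z1_gt0 : 0 < dnorm z1 by rewrite (le_lt_trans _ etaz1)// divr_ge0 ?ltW.
exfalso; apply: noc; exists (z2 * z1^-1).
rewrite dnormM dnormV ltr_pdivlMr// mul1r; split=> //.
have cle : dnorm z2 / dnorm z1 <= eta.
  rewrite ler_pdivrMr// mulrC; move: etaz1; rewrite ltr_pdivrMr// => rz1.
  by rewrite ltW// (lt_trans z2r).
rewrite (@le_trans _ _ (eta ^+ n))//.
  by rewrite lerXn2r// nnegrE ?divr_ge0 ?dnorm_ge0// ltW.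
by rewrite -etaq ler_weXn2l// ltW.
Qed.

(** N maps balls of radius r into balls of radius |c| r for a dominating scalar c,
    and |c|^n is the ratio of their measures. *)
Lemma mulmx_preimage_rho_ball (n_gt0 : (0 < n)%N) (M N : 'M[K]_n) x r :
  0 < r -> M *m N = 1%:M -> N *m M = 1%:M ->
  exists y s, [/\ 0 < s, (fun v : V => M *m v) @^-1` rho_ball x r `<=` rho_ball y s &
    (mu (rho_ball y s) <=
       ((2 * row_sum_norm N) ^+ n)%:E * mu (rho_ball x r))%E].
Proof.
move=> r0 MN NM.
have N0 : N != 0.
  apply/eqP => N0; move: NM; rewrite N0 mul0mx => /matrixP.
  move=> /(_ (Ordinal n_gt0) (Ordinal n_gt0)); rewrite !mxE eqxx => /esym/eqP.
  by rewrite oner_eq0.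
have [c [c0 ck] Nc] := dominating_scalar N0.
have c_gt0 : 0 < dnorm c by rewrite dnorm_gt0.
exists (N *m x), (dnorm c * r); split; first by rewrite mulr_gt0.
  move=> v /rho_ballP[_ xv]; apply/rho_ballP; split=> [|i]; first by rewrite mulr_gt0.
  have := Nc r (x - M *m v) _ i; rewrite mulmxBr mulmxA NM mul1mx !mxE; apply=> j.
  by rewrite mxE [X in _ + X]mxE; exact: xv.
rewrite haar_rho_ball_scale// haar_rho_ball_translate -(haar_rho_ball_translate x).
apply: lee_wpmul2r => //; rewrite lee_fin.
have k0 : 0 <= 2 * row_sum_norm N by rewrite mulr_ge0// row_sum_norm_ge0.
by rewrite lerXn2r// nnegrE// ltW.
Qed.
End balls.

(** * Averages of multiples of atoms *)

Lemma cvg_series_abs (R : realType) (u : nat -> R) :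
  (\sum_(0 <= k <oo) `|u k|%:E < +oo)%E ->
  series u @ \oo --> fine (\sum_(0 <= k <oo) (u k)%:E)%E.
Proof.
move=> uoo.
have cu : cvgn (series u).
  apply: normed_cvg; apply: nondecreasing_is_cvgn.
    by apply: nondecreasing_series => k _ _; exact: normr_ge0.
  have s_fin : (\sum_(0 <= k <oo) `|u k|%:E)%E \is a fin_num.
    by rewrite ge0_fin_numE// nneseries_ge0// => k _ _; rewrite lee_fin.
  exists (fine (\sum_(0 <= k <oo) `|u k|%:E)%E) => _ [k _ <-].
  rewrite -lee_fin fineK// /series/= -sumEFin.
  by apply: nneseries_lim_ge => i _ _; rewrite lee_fin.
suff -> : (\sum_(0 <= k <oo) (u k)%:E)%E = (limn (series u))%:E by exact: cu.
rewrite -EFin_lim//; congr (limn _); apply/funext => k /=.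
by rewrite /series/= sumEFin.
Qed.

Lemma normr_indic (X : Type) (R : realType) (A : set X) (x : X) :
  `|\1_A x| = \1_A x :> R.
Proof. by rewrite ger0_norm. Qed.

Lemma indic_le1 (X : Type) (R : realType) (A : set X) (x : X) :
  \1_A x <= 1 :> R.
Proof. by rewrite indicE lern1 leq_b1. Qed.

Section averages_of_atoms.
Local Open Scope ereal_scope.
Context dO dT (Om : measurableType dO) (T : measurableType dT) (R : realType).
Variables (P : {sigma_finite_measure set Om -> \bar R})
  (mu : {sigma_finite_measure set T -> \bar R}).
Variable B : nat -> set T.
Hypotheses (mB : forall m, measurable (B m)) (B_gt0 : forall m, 0 < mu (B m)).
Variables (g : Om * T -> R) (bound : Om -> R) (vol : Om -> \bar R) (L q : R).
Hypotheses (mg : measurable_fun setT g) (mbound : measurable_fun setT bound).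
Hypothesis g_bound : forall w x, (`|g (w, x)| <= bound w)%R.
Hypothesis q_gt1 : (1 < q)%R.
Hypothesis g_supp : forall w, exists2 m,
  (forall x, g (w, x) != 0%R -> B m x) & mu (B m) <= q%:E * vol w.
Hypothesis g_mean0 : forall w, \int[mu]_x (g (w, x))%:E = 0.
Hypothesis vol_ge0 : forall w, 0 <= vol w.
(* an upper bound for the lower integral of bound * vol, a product that may fail
   to be measurable *)
Hypothesis bound_vol : forall h : Om -> \bar R, measurable_fun setT h ->
  (forall w, 0 <= h w) -> (forall w, h w <= (bound w)%:E * vol w) ->
  \int[P]_w h w <= L%:E.

Let q0 : (0 < q)%R. Proof. exact: lt_trans q_gt1. Qed.
Let bound_ge0 w : (0 <= bound w)%R.
Proof. exact: le_trans (normr_ge0 _) (g_bound w point). Qed.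

Let mgE : measurable_fun setT (EFin \o g). Proof. exact/measurable_EFinP. Qed.
Let mgabs : measurable_fun setT (abse \o (EFin \o g)).
Proof. exact: measurableT_comp. Qed.
Let mgw w : measurable_fun setT (fun x => (g (w, x))%:E).
Proof. exact: measurableT_comp mgE (pair1_measurable w). Qed.
Let mgwR w : measurable_fun setT (fun x => g (w, x)).
Proof. exact: measurableT_comp mg (pair1_measurable w). Qed.
Let mgx x : measurable_fun setT (fun w => (g (w, x))%:E).
Proof. exact: measurableT_comp mgE (pair2_measurable x). Qed.

(* w belongs to carries m when B m contains almost all of the support of g (w, .) *)
Let off m w := \int[mu]_x (`|g (w, x)| * \1_(~` B m) x)%:E.
Let carries m := [set w | off m w = 0].

Let mcarries m : measurable (carries m).
Proof.
pose f (p : Om * T) := (`|g p| * \1_(~` B m) p.2)%:E.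
have mf : measurable_fun setT f.
  apply/measurable_EFinP; apply: measurable_funM; first exact: measurableT_comp.
  apply: measurableT_comp => //; apply: measurable_indic.
  exact: measurableC.
have f0 p : 0 <= f p by rewrite lee_fin mulr_ge0.
have := measurable_fun_fubini_tonelli_F (m2 := mu) f mf f0.
move=> /(_ measurableT [set 0] (emeasurable_set1 _)).
by rewrite setTI.
Qed.

(* Among the balls that carry g (w, .), those of nearly minimal measure.  They are
   selected through the measurable sets carries l, whereas vol, which in the
   application is built from inverse matrices, need not be measurable. *)
Let near_min m := carries m `&`
  \bigcap_l (if mu (B m) <= q%:E * mu (B l) then setT else ~` carries l).

Let U := seqDU near_min.

Let mU m : measurable (U m).
Proof.
apply: seqDU_measurable => k; apply: measurableI => //.
apply: bigcapT_measurable => l.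
by case: ifP => // _; exact: measurableC.
Qed.

Let tU : trivIset setT U. Proof. exact: trivIset_seqDU. Qed.

Let U_carries m w : U m w -> carries m w.
Proof. by move=> Uw; have [] : near_min m w by exact: subset_seqDU Uw. Qed.

Let supp_carries m w : (forall x, g (w, x) != 0%R -> B m x) -> carries m w.
Proof.
move=> gB; rewrite /carries/= /off integral0_eq// => x _.
have [->|/gB Bx] := eqVneq (g (w, x)) 0%R; first by rewrite normr0 mul0r.
by rewrite indicE memNset ?mulr0//; exact.
Qed.

Let U_vol m w : U m w -> mu (B m) <= (q * q)%:E * vol w.
Proof.
move=> Uw; have [_ min] : near_min m w by exact: subset_seqDU Uw.
have [l gl lvol] := g_supp w.
have := min l I; case: ifP => [mle _|_ /(_ (supp_carries gl))//].
by rewrite EFinM -muleA (le_trans mle)// lee_wpmul2l// lee_fin ltW.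
Qed.

Let bound_indic m w : \int[mu]_x (bound w * \1_(B m) x)%:E = (bound w)%:E * mu (B m).
Proof.
under eq_integral do rewrite EFinM.
rewrite ge0_integralZl_EFin ?integral_indic ?setIT//.
by apply/measurable_EFinP; exact: measurable_indic.
Qed.

Let mass_carries m w : carries m w ->
  \int[mu]_x `|(g (w, x))%:E| <= (bound w)%:E * mu (B m).
Proof.
rewrite /carries/= /off => c.
have mind (S : set T) : measurable S ->
    measurable_fun setT (fun x => (`|g (w, x)| * \1_S x)%:E).
  move=> mS; apply/measurable_EFinP; apply: measurable_funM.
    exact: measurableT_comp.
  exact: measurable_indic.
rewrite (_ : \int[mu]_x _ = \int[mu]_x ((`|g (w, x)| * \1_(B m) x)%:E +
    (`|g (w, x)| * \1_(~` B m) x)%:E)); last first.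
  apply: eq_integral => x _; rewrite -EFinD -mulrDr !indicE in_setC.
  by case: (x \in B m); rewrite /= ?addr0 ?add0r mulr1.
rewrite ge0_integralD//; [|exact: mind|exact/mind/measurableC].
rewrite c adde0 -bound_indic; apply: ge0_le_integral => //.
- exact: mind.
- by apply/measurable_EFinP; apply: measurable_funM => //; exact: measurable_indic.
- by move=> x _; rewrite lee_fin ler_wpM2r.
Qed.

Let U_cover w : ~ (\bigcup_m U m) w -> \int[mu]_x `|(g (w, x))%:E| = 0.
Proof.
rewrite -seqDU_bigcup_eq => nU; apply/eqP; apply: contra_notT nU => I_neq0.
set I0 := \int[mu]_x _ in I_neq0.
have I_gt0 : 0 < I0 by rewrite lt0e I_neq0 integral_ge0.
have [m0 cm0] : exists m, carries m w.
  by have [l gl _] := g_supp w; exists l; exact: supp_carries.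
have bound_gt0 : (0 < bound w)%R.
  rewrite lt_neqAle bound_ge0 andbT; apply: contraTN I_gt0 => /eqP b0.
  by rewrite -leNgt (le_trans (mass_carries cm0))// -b0 mul0e.
(* the measures of the balls that carry g (w, .) are bounded below, as g (w, .) is
   bounded and its mass is I0 > 0 *)
pose S := [set t | exists2 l, carries l w & t = mu (B l)].
have S_gt0 : 0 < ereal_inf S.
  apply: (@lt_le_trans _ _ ((bound w)^-1%:E * I0)).
    by rewrite mule_gt0// lte_fin invr_gt0.
  apply/ereal_infP => _ [l cl ->]; rewrite lee_pdivrMl//.
  exact: mass_carries.
suff [m cm mS] : exists2 m, carries m w & mu (B m) <= q%:E * ereal_inf S.
  exists m => //; split=> // l _; case: ifPn => //; rewrite -ltNge => lm cl.
  move: lm; rewrite ltNge => /negP; apply; apply: le_trans mS _.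
  by rewrite lee_wpmul2l ?lee_fin ?(ltW q0)//; apply: ereal_inf_lbound; exists l.
have [Soo|Soo] := eqVneq (ereal_inf S) +oo.
  by exists m0 => //; rewrite Soo gt0_muley ?leey// lte_fin.
have S_fin : ereal_inf S \is a fin_num by rewrite ge0_fin_numE ?ltW// lt_neqAle Soo leey.
have : ereal_inf S < q%:E * ereal_inf S.
  by rewrite -(fineK S_fin) -EFinM lte_fin ltr_pMl// fine_gt0// S_gt0 ltey.
by move=> /ereal_inf_lt[_ [m cm ->] /ltW mS]; exists m.
Qed.

(* the integral of h over P is the sum of the coefficients of the atoms *)
Let h w := \sum_(0 <= m <oo) ((bound w * \1_(U m) w)%:E * mu (B m)).

Let hE m w : U m w -> h w = (bound w)%:E * mu (B m).
Proof.
move=> Uw; rewrite /h (nneseriesD1 (n := m))//; last first.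
  by move=> k _; rewrite mule_ge0// lee_fin mulr_ge0.
rewrite indicE mem_set// mulr1 eseries0 ?adde0// => k _ /andP[_ km].
rewrite indicE memNset ?mulr0 ?mul0e// => Ukw.
by move/eqP : km; apply; apply: (tU I I); exists w.
Qed.

Let hE0 w : ~ (\bigcup_m U m) w -> h w = 0.
Proof.
move=> nU; rewrite /h eseries0// => k _ _.
by rewrite indicE memNset ?mulr0 ?mul0e// => Uk; apply: nU; exists k.
Qed.

Let h_ge0 w : 0 <= h w.
Proof. by apply: nneseries_ge0 => k _ _; rewrite mule_ge0// lee_fin mulr_ge0. Qed.

Let mass_le w : \int[mu]_x `|(g (w, x))%:E| <= h w.
Proof.
have [[m _ Uw]|nU] := pselect ((\bigcup_m U m) w); last by rewrite U_cover// hE0.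
by rewrite (hE Uw); exact/mass_carries/U_carries.
Qed.

Let mh_term m : measurable_fun setT (fun w => (bound w * \1_(U m) w)%:E).
Proof.
by apply/measurable_EFinP; apply: measurable_funM => //; exact: measurable_indic.
Qed.

Let mh : measurable_fun setT h.
Proof.
apply: ge0_emeasurable_sum => [k w _ _|k _].
  by rewrite mule_ge0// lee_fin mulr_ge0.
apply: emeasurable_funM => //; exact: measurable_cst.
Qed.

Let int_h : \int[P]_w h w <= (q * q * L)%:E.
Proof.
have qq0 : (0 < q * q)%R by rewrite mulr_gt0.
rewrite EFinM -lee_pdivrMl// -ge0_integralZl_EFin//; last by rewrite invr_ge0 ltW.
apply: bound_vol.
- by apply: emeasurable_funM => //; exact: measurable_cst.
- by move=> w; rewrite mule_ge0// lee_fin invr_ge0 ltW.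
- move=> w; rewrite lee_pdivrMl//.
  have [[m _ Uw]|nU] := pselect ((\bigcup_m U m) w); last first.
    by rewrite hE0// !mule_ge0// lee_fin// ltW.
  by rewrite (hE Uw) muleCA lee_wpmul2l ?lee_fin// U_vol.
Qed.

Let integrable_g : (P \x mu).-integrable setT (EFin \o g).
Proof.
apply/(integrable12ltyP _ _ mgE); apply: (@le_lt_trans _ _ (q * q * L)%:E); last first.
  exact: ltry.
apply: le_trans int_h; apply: ge0_le_integral => //.
- by move=> w _; exact: integral_ge0.
- exact: (measurable_fun_fubini_tonelli_F (m2 := mu) (abse \o (EFin \o g)) mgabs
    (fun=> abse_ge0 _)).
- by move=> w _; exact: mass_le.
Qed.

Let c m := \int[P]_w (bound w * \1_(U m) w)%:E.
Let lamE m := c m * mu (B m).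

Let c_ge0 m : 0 <= c m.
Proof. by apply: integral_ge0 => w _; rewrite lee_fin mulr_ge0. Qed.

Let lamE_ge0 m : 0 <= lamE m. Proof. exact: mule_ge0. Qed.

Let sum_lamE : \sum_(0 <= m <oo) lamE m <= (q * q * L)%:E.
Proof.
apply: le_trans int_h; rewrite /h integral_nneseries//; last 2 first.
- by move=> m; apply: emeasurable_funM => //; exact: measurable_cst.
- by move=> m w _; rewrite mule_ge0// lee_fin mulr_ge0.
apply: lee_nneseries => [m _ _|m _]; first by rewrite mule_ge0.
rewrite ge0_integralZr// => w _; by rewrite lee_fin mulr_ge0.
Qed.

Let lamE_fin m : lamE m \is a fin_num.
Proof.
rewrite ge0_fin_numE ?mule_ge0//; apply: le_lt_trans (ltry (q * q * L)).
apply: le_trans sum_lamE; rewrite (nneseriesD1 (n := m))//.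
by rewrite leeDl// nneseries_ge0.
Qed.

Let c_fin m : c m \is a fin_num.
Proof.
rewrite ge0_fin_numE// ltNge leye_eq; apply/negP => /eqP coo.
by have := lamE_fin m; rewrite /lamE coo gt0_mulye.
Qed.

Let gm m (p : Om * T) := (g p * (\1_(U m) p.1 * \1_(B m) p.2))%R.

Let mgm m : measurable_fun setT (EFin \o gm m).
Proof.
apply/measurable_EFinP; apply: measurable_funM => //; apply: measurable_funM.
  by apply: measurableT_comp => //; exact: measurable_indic.
by apply: measurableT_comp => //; exact: measurable_indic.
Qed.

Let gm_le m w x : (`|gm m (w, x)| <= bound w * \1_(U m) w)%R.
Proof.
rewrite /gm/= mulrA !normrM !normr_indic -[leRHS]mulr1.
by rewrite ler_pM ?mulr_ge0 ?ler_wpM2r ?indic_le1.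
Qed.

Let integrable_gm m : (P \x mu).-integrable setT (EFin \o gm m).
Proof.
apply: le_integrable integrable_g => // p _.
rewrite /= lee_fin /gm !normrM !normr_indic.
by rewrite ler_piMr// mulr_ile1 ?indic_le1.
Qed.

Let average m x := \int[P]_w (gm m (w, x))%:E.

Let average_le m x : `|average m x| <= c m.
Proof.
have mgmx : measurable_fun setT (fun w => (gm m (w, x))%:E).
  exact: measurableT_comp (mgm m) (pair2_measurable x).
apply: le_trans (le_abse_integral _ _ mgmx) _ => //.
apply: ge0_le_integral => //; first exact: measurableT_comp.
by move=> w _; rewrite lee_fin gm_le.
Qed.

Let average_fin m x : average m x \is a fin_num.
Proof.
by rewrite fin_num_abs (le_lt_trans (average_le m x))// ltey_eq c_fin.
Qed.

Let average_supp m x : ~ B m x -> average m x = 0.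
Proof.
move=> nBx; rewrite /average integral0_eq// => w _.
by rewrite /gm/= [\1_(B m) x]indicE memNset// !mulr0.
Qed.

Let average_mean0 m : \int[mu]_x average m x = 0.
Proof.
rewrite -(Fubini (integrable_gm m)) integral0_eq// => w _.
have [Uw|nUw] := pselect (U m w); last first.
  rewrite integral0_eq// => x _; rewrite /= /gm/= [\1_(U m) w]indicE memNset//.
  by rewrite mul0r mulr0.
rewrite -[RHS](g_mean0 w); apply: ae_eq_integral => //.
  exact: measurableT_comp (mgm m) (pair1_measurable w).
have moff : measurable_fun setT (fun x => (g (w, x) * \1_(~` B m) x)%:E).
  apply/measurable_EFinP; apply: measurable_funM => //.
  exact/measurable_indic/measurableC.
have /(ae_eq_integral_abs mu measurableT moff) : \int[mu]_x `|(g (w, x) * \1_(~` B m) x)%:E| = 0.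
  rewrite -[RHS](U_carries Uw); apply: eq_integral => x _.
  by rewrite /= normrM normr_indic.
apply: filterS => x /(_ I)/= [gx0] _; congr _%:E.
rewrite /gm/= [\1_(U m) w]indicE mem_set// mul1r indicE.
have [//|nBx] := boolP (x \in B m); first by rewrite mulr1.
by move: gx0; rewrite indicE in_setC nBx mulr1 mulr0 => ->.
Qed.

(* outside the blocks U m x B m, g has no mass on almost every section *)
Let stray (p : Om * T) := (`|g p| * \1_(~` \bigcup_m (U m `*` B m)) p)%:E.

Let mstray : measurable_fun setT stray.
Proof.
apply/measurable_EFinP; apply: measurable_funM; first exact: measurableT_comp.
apply/measurable_indic/measurableC/bigcupT_measurable => m.
exact: measurableX.
Qed.

Let stray_ge0 p : 0 <= stray p. Proof. by rewrite lee_fin mulr_ge0. Qed.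

Let stray_null : \forall x \ae mu, \int[P]_w stray (w, x) = 0.
Proof.
have int0 : \int[mu]_x \int[P]_w stray (w, x) = 0.
  rewrite -(fubini_tonelli stray mstray stray_ge0) integral0_eq// => w _.
  apply/eqP; rewrite eq_le integral_ge0// andbT.
  have mst : measurable_fun setT (fun x => stray (w, x)).
    exact: measurableT_comp mstray (pair1_measurable w).
  have [[m _ Uw]|nU] := pselect ((\bigcup_m U m) w).
    rewrite -(U_carries Uw); apply: ge0_le_integral => //.
    - apply/measurable_EFinP; apply: measurable_funM; first exact: measurableT_comp.
      exact/measurable_indic/measurableC.
    - move=> x _; rewrite lee_fin ler_wpM2l//.
      have [Bx|nBx] := pselect (B m x); last first.
        by rewrite [leRHS]indicE mem_set// indic_le1.
      rewrite [leLHS]indicE memNset// => -[]; exists m => //.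
  rewrite -(U_cover nU); apply: ge0_le_integral => //.
  - exact: measurableT_comp.
  - by move=> x _; rewrite lee_fin ler_piMr// indic_le1.
have mint : measurable_fun setT (fun x => \int[P]_w stray (w, x)).
  exact: (measurable_fun_fubini_tonelli_G (m1 := P) stray mstray stray_ge0).
have /(ae_eq_integral_abs mu measurableT mint) :
    \int[mu]_x `|\int[P]_w stray (w, x)| = 0.
  rewrite -[RHS]int0; apply: eq_integral => x _.
  by rewrite gee0_abs// integral_ge0.
by apply: filterS => x /(_ I).
Qed.

Let section m x := [set w | U m w /\ B m x].

Let int_section m x : \int[P]_(w in section m x) (g (w, x))%:E = average m x.
Proof.
rewrite integral_mkcond; apply: eq_integral => w _; rewrite patchE /gm/= !indicE.
have [|ns] := boolP (w \in section m x).
  by rewrite inE => -[Uw Bx]; rewrite !mem_set// !mulr1.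
have [/set_mem Uw|] := boolP (w \in U m); last by rewrite mul0r mulr0.
have [/set_mem Bx|] := boolP (x \in B m); last by rewrite mulr0 mulr0.
by move/negP : ns; case; apply/mem_set.
Qed.

Let int_sections x : P.-integrable setT (fun w => (g (w, x))%:E) ->
  \int[P]_w stray (w, x) = 0 ->
  series (fun m => fine (average m x)) @ \oo --> fine (\int[P]_w (g (w, x))%:E).
Proof.
move=> ig st0.
have ms m : measurable (section m x).
  rewrite /section; have [Bx|nBx] := pselect (B m x).
    by rewrite (_ : mkset _ = U m)//; apply/seteqP; split => // w [].
  by rewrite (_ : mkset _ = set0)//; apply/seteqP; split => // w [].
have ts : trivIset setT (section ^~ x).
  by move=> i j _ _ [w [[Uiw _] [Ujw _]]]; apply: (tU I I); exists w.
pose D := \bigcup_m section m x.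
have mD : measurable D by exact: bigcupT_measurable.
have igD : P.-integrable D (fun w => (g (w, x))%:E) by exact: integrableS ig.
have offD : \int[P]_(w in ~` D) (g (w, x))%:E = 0.
  apply/eqP; rewrite -abse_eq0 eq_le abse_ge0 andbT -st0.
  apply: le_trans (le_abse_integral _ _ _) _ => //.
  - exact: measurableC.
  - exact: measurable_funTS.
  rewrite integral_mkcond; apply: ge0_le_integral => //.
  - by move=> w _; rewrite patchE; case: ifP.
  - apply/(measurable_restrictT _ _).1; first exact: measurableC.
    by apply: measurableT_comp => //; exact: measurable_funTS.
  - exact: measurableT_comp mstray (pair2_measurable x).
  - move=> w _; rewrite patchE; case: ifPn => [/set_mem nD|_]; last exact: stray_ge0.
    by rewrite lee_fin indicE mem_set ?mulr1// => -[m _ [/= Uw Bx]]; apply: nD; exists m.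
have intE : \int[P]_w (g (w, x))%:E = \sum_(0 <= m <oo) (fine (average m x))%:E.
  rewrite -(setUv D) integral_setU//; last 3 first.
  - exact: measurableC.
  - by rewrite setUv.
  - by rewrite disj_set2E setICr.
  rewrite offD adde0 integral_bigcup//; apply: eq_eseriesr => m _.
  by rewrite int_section fineK.
rewrite intE; apply: cvg_series_abs.
have := integrable_summable ts ms igD; rewrite /summable -nneseries_esumT//.
apply: le_lt_trans; apply: lee_nneseries => // m _.
by rewrite int_section -abse_EFin fineK.
Qed.

(** Minkowski's inequality for atoms.  On the block U m, cut out by choosing a ball
    B m that carries g (w, .), the average of g (w, .) is a function of mean zero
    on B m, at most the integral of bound over U m in absolute value: an atom,
    times that integral times mu (B m).  Up to q^2 the sum of these coefficients
    is the integral of bound * vol. *)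
Lemma averages_of_atoms : exists (lam : nat -> R) (b : nat -> T -> R),
  [/\ forall m, (0 <= lam m)%R,
      \sum_(0 <= m <oo) (lam m)%:E <= (q * q * L)%:E,
      forall m, [/\ measurable_fun setT (b m),
        forall x, b m x != 0%R -> B m x,
        forall x, `|b m x|%:E <= (mu (B m))^-1 &
        \int[mu]_x (b m x)%:E = 0] &
      \forall x \ae mu, P.-integrable setT (fun w => (g (w, x))%:E) /\
        series (fun m => lam m * b m x)%R @ \oo -->
          fine (\int[P]_w (g (w, x))%:E)].
Proof.
(* a vanishing coefficient comes with a vanishing average, so that dividing by it
   is harmless *)
have mav m : measurable_fun setT (average m).
  exact: (measurable_fubini_G (integrable_gm m)).
have lam0 m : fine (lamE m) = 0%R -> c m = 0.
  move=> /eqP; rewrite fine_eq0// mule_eq0 => /orP[/eqP//|/eqP B0].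
  by have := B_gt0 m; rewrite B0 ltxx.
exists (fun m => fine (lamE m)), (fun m x => (fine (lamE m))^-1 * fine (average m x))%R.
split.
- by move=> m; exact: fine_ge0.
- by under eq_eseriesr do rewrite fineK//.
- move=> m; split.
  + apply: measurable_funM => //.
    by apply: measurableT_comp (mav m); exact: fine_measurable.
  + move=> x; apply: contra_neqP => nBx; by rewrite average_supp//= mulr0.
  + move=> x; have [l0|l0] := eqVneq (fine (lamE m)) 0%R.
      by rewrite l0 invr0 mul0r normr0 inve_ge0.
    have c_gt0 : 0 < c m.
      by rewrite lt0e c_ge0 andbT; apply: contra_neq l0 => c0; rewrite /lamE c0 mul0e.
    have fc0 : (0 < fine (c m))%R by rewrite fine_gt0// c_gt0 ltey_eq c_fin.
    have mu_fin : mu (B m) \is a fin_num.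
      rewrite ge0_fin_numE// ltNge leye_eq; apply/negP => /eqP Boo.
      by have := lamE_fin m; rewrite /lamE Boo gt0_muley.
    have fmu0 : (0 < fine (mu (B m)))%R by rewrite fine_gt0// B_gt0 ltey_eq mu_fin.
    rewrite /lamE fineM// -[X in _ <= X](_ : ((fine (mu (B m)))^-1)%:E = _); last first.
      by rewrite -{2}(fineK mu_fin) inver gt_eqF.
    rewrite lee_fin normrM ger0_norm ?invr_ge0 ?mulr_ge0 ?fine_ge0//.
    rewrite ler_pdivrMl ?mulr_gt0// mulfK ?gt_eqF//.
    by rewrite -lee_fin fineK// -abse_EFin fineK//.
  + under eq_integral do rewrite EFinM fineK//.
    rewrite integralZl// ?average_mean0 ?mule0//.
    apply/integrableP; split=> //.
    have /(integrable21ltyP _ _ (mgm m)) := integrable_gm m; apply: le_lt_trans.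
    apply: ge0_le_integral => //.
    * by apply: (measurableT_comp (f := abse)) => //; exact: mav.
    * have mabs : measurable_fun setT (abse \o (EFin \o gm m)).
        by apply: measurableT_comp => //; exact: mgm.
      exact: (measurable_fun_fubini_tonelli_G (m1 := P) _ mabs (fun=> abse_ge0 _)).
    * move=> x _; apply: le_abse_integral => //.
      exact: measurableT_comp (mgm m) (pair2_measurable x).
- move: (ae_integrable2 integrable_g) stray_null; apply: filterS2 => x ig st0.
  split; first exact: ig.
  rewrite (_ : (fun m => _) = (fun m => fine (average m x))); first exact: int_sections.
  apply/funext => m; have [l0|l0] := eqVneq (fine (lamE m)) 0%R; last by rewrite mulVKf.
  rewrite l0 mul0r; apply/esym/eqP; rewrite fine_eq0// -abse_eq0.
  by rewrite eq_le abse_ge0 andbT -(lam0 _ l0).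
Qed.

End averages_of_atoms.

(** * Integrals without measurability, atoms and linear changes of variables *)

Section almost_everywhere.
Context d (T : measurableType d) (R : realType) (mu : {measure set T -> \bar R}).
Implicit Types P Q : T -> Prop.

Lemma ae_imply P Q : (forall x, P x -> Q x) ->
  (\forall x \ae mu, P x) -> \forall x \ae mu, Q x.
Proof. by move=> PQ; apply: filterS. Qed.

Lemma ae_and P Q : (\forall x \ae mu, P x) -> (\forall x \ae mu, Q x) ->
  \forall x \ae mu, P x /\ Q x.
Proof. by move=> aP aQ; apply: filterS2 aP aQ. Qed.

End almost_everywhere.

Section integrals_without_measurability.
Local Open Scope ereal_scope.
Context d (T : measurableType d) (R : realType) (mu : {measure set T -> \bar R}).
Implicit Types f g : T -> \bar R.
Import HBNNSimple.

Lemma le_lower_integral f g : (forall x, 0 <= f x) -> (forall x, f x <= g x) ->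
  \int[mu]_x f x <= \int[mu]_x g x.
Proof.
move=> f0 fg; rewrite !ge0_integralTE// => [|x]; last exact: le_trans (fg x).
apply: le_ereal_sup => _ [h hf <-]; exists h => // x.
exact: le_trans (hf x) (fg x).
Qed.

(** The integral of a nonnegative function that is not measurable is the supremum
    over simple functions below it, and a null set can be cut out of those. *)
Lemma ge0_ae_le_lower_integral f g : (forall x, 0 <= f x) -> (forall x, 0 <= g x) ->
  (\forall x \ae mu, f x = g x) -> \int[mu]_x f x <= \int[mu]_x g x.
Proof.
move=> f0 g0 [N [mN N0 fgN]]; rewrite ge0_integralTE//.
apply: ge_ereal_sup => _ [h hf <-]; rewrite -integralT_nnsfun.
have mh : measurable_fun setT (EFin \o h) by exact/measurable_EFinP.
have mhN : measurable_fun setT (fun x => (h x * \1_(~` N) x)%:E).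
  apply/measurable_EFinP; apply: measurable_funM => //.
  exact/measurable_indic/measurableC.
rewrite (ge0_ae_eq_integral (g := fun x => (h x * \1_(~` N) x)%:E))//; last 3 first.
- by move=> x _; rewrite lee_fin.
- by move=> x _; rewrite lee_fin mulr_ge0.
- exists N; split => // x /= hN; apply: contrapT => Nx; apply: hN => _.
  by rewrite indicE mem_set// mulr1.
apply: le_lower_integral => x; first by rewrite lee_fin mulr_ge0.
have [Nx|Nx] := pselect (N x); first by rewrite indicE memNset ?mulr0.
rewrite indicE mem_set// mulr1 (le_trans (hf x))//.
by rewrite (_ : f x = g x)//; apply: contrapT => fgx; exact/Nx/fgN.
Qed.

Lemma ae_eq_lower_integral f g : (\forall x \ae mu, f x = g x) ->
  \int[mu]_x f x = \int[mu]_x g x.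
Proof.
move=> fg; rewrite integralE [RHS]integralE; congr (_ - _); apply/eqP;
  rewrite eq_le; apply/andP; split; apply: ge0_ae_le_lower_integral => //;
  apply: filterS fg => x; rewrite ?funeposE ?funenegE /= => ->//.
Qed.

End integrals_without_measurability.

Lemma measurable_fun_prod_nat d d' (X : measurableType d) (Y : measurableType d')
    (f : X * nat -> Y) :
  (forall j, measurable_fun setT (fun x => f (x, j))) -> measurable_fun setT f.
Proof.
move=> mf _ E mE; rewrite setTI.
rewrite (_ : _ @^-1` _ = \bigcup_j (((fun x => f (x, j)) @^-1` E) `*` [set j])).
  apply: bigcupT_measurable => j; apply: measurableX => //.
  by rewrite -[X in measurable X]setTI; exact: mf.
apply/seteqP; split => [[x j] /= Ef|[x j] [i _ [/= Ef ->]]//].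
by exists j.
Qed.

Section atoms_and_matrices.
Context (R : realType) (K : normedDivisionRingType R) (n : nat).
Local Notation V := 'cV[K]_n.
Hypotheses (lcK : locally_compact [set: K]) (scK : sigma_compact K).
Variable mu : {measure set (borel V) -> \bar R}.
Hypothesis hmu : haar_measure V +%R mu.

(** Truncate the atom where it exceeds its essential bound: pointwise bounds keep
    exceptional sets that depend on u out of the averages over u. *)
Lemma atom_representative (a : V -> R) : atom mu a ->
  exists (b : borel V -> R) (s : R) (x : V) (r : R),
  [/\ 0 < r, measurable_fun setT b & \forall y \ae mu, b y = a y] /\
  [/\ forall y, `|b y| <= s,
      forall y, b y != 0 -> rho_ball x r y,
      (s%:E * mu (rho_ball x r) <= 1)%E & (\int[mu]_y (b y)%:E = 0)%E].
Proof.
move=> [ma [x [r [r0 [a_supp a_bound a0]]]]].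
have B_gt0 := haar_rho_ball_gt0 hmu x r0.
set B := rho_ball x r in a_supp a_bound B_gt0 *.
have muT : (0 < mu setT)%E.
  by apply: lt_le_trans B_gt0 _; apply: le_measure; rewrite ?inE//; exact: measurable_rho_ball.
pose s := fine (mu B)^-1%E.
have sE : ((mu B)^-1 = s%:E)%E.
  rewrite /s fineK// fin_numE inve_eqNy inve_eqy.
  by rewrite (gt_eqF B_gt0) gt_eqF// (lt_trans _ B_gt0)// ltNy0.
have s0 : 0 <= s by rewrite -lee_fin -sE inve_ge0 ltW.
have ae_s : \forall y \ae mu, `|a y| <= s.
  move: a_bound; rewrite sE unlock muT => /ess_sup_inf.ess_supP; apply: filterS => y /=.
  by rewrite lee_fin.
pose b (y : borel V) : R := if `|a y| <= s then a y else 0.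
have ba : \forall y \ae mu, b y = a y.
  by apply: ae_imply ae_s => y; rewrite /b => ->.
have mb : measurable_fun [set: borel V] b.
  apply: measurable_fun_ifT => //.
  apply: measurable_fun_ler; last exact: measurable_cst.
  exact: measurableT_comp.
exists b, s, x, r; split; split => //.
- by move=> y; rewrite /b; case: ifPn => // _; rewrite normr0.
- move=> y; rewrite /b; case: ifPn => [_|_]; last by rewrite eqxx.
  exact: a_supp.
- rewrite -sE -/B; have [->|Boo] := eqVneq (mu B) +oo%E; first by rewrite invey mul0e.
  have Bfin : mu B \is a fin_num by rewrite ge0_fin_numE ?ltW// lt_neqAle Boo leey.
  have fB : fine (mu B) != 0 by rewrite gt_eqF// fine_gt0// B_gt0 ltey_eq Bfin.
  by rewrite -(fineK Bfin) inver (negbTE fB) -EFinM mulVf.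
- rewrite -[RHS]a0; apply: ae_eq_lower_integral.
  by apply: ae_imply ba => y ->.
Qed.

Section change_of_variables.
Variables M N : 'M[K]_n.
Hypotheses (MN : M *m N = 1%:M) (NM : N *m M = 1%:M).

Lemma ge0_integral_mulmx : exists2 c : R, 0 < c &
  forall f : borel V -> \bar R, measurable_fun setT f -> (forall y, 0 <= f y)%E ->
  (\int[mu]_y f (M *m (y : V)) = c%:E * \int[mu]_y f y)%E.
Proof.
have [c c0 cE] := haar_mulmx lcK scK hmu MN NM.
exists c => // f mf f0.
have mM := @measurable_mulmxl _ _ n M.
have c0' := ltW c0.
rewrite -(ge0_integral_mscale mu measurableT (NngNum c0') mf)//.
transitivity (\int[pushforward mu ((fun v => M *m v) : borel V -> borel V)]_y f y)%E.
  by rewrite [RHS](ge0_integral_pushforward mM mu measurableT mf).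
by apply: eq_measure_integral => E mE _; exact: cE.
Qed.

Lemma mulmx_null (E : set (borel V)) : measurable E -> mu E = 0%E ->
  mu [set y : V | E (M *m y)] = 0%E.
Proof.
by move=> mE E0; have [c c0 cE] := haar_mulmx lcK scK hmu MN NM; rewrite (cE E mE) E0 mule0.
Qed.

(** The integral of f (M y) is a constant times that of f. *)
Lemma integral_mulmx_eq0 (f : borel V -> R) : mu.-integrable setT (EFin \o f) ->
  (\int[mu]_y (f y)%:E = 0)%E ->
  mu.-integrable setT (fun y : borel V => (f (M *m (y : V)))%:E) /\
  (\int[mu]_y (f (M *m (y : V)))%:E = 0)%E.
Proof.
move=> intf f0; have [c c0 cE] := ge0_integral_mulmx.
have mf := measurable_int _ intf.
have mfM : measurable_fun setT (fun y : borel V => (f (M *m (y : V)))%:E).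
  exact: measurableT_comp mf (@measurable_mulmxl _ _ n M).
split.
  apply/integrableP; split=> //.
  rewrite (cE (fun y => `|(f y)%:E|%E))//; last exact: measurableT_comp.
  have /integrableP[_ foo] := intf.
  by rewrite lte_mul_pinfty// lee_fin ltW.
have pos := cE _ (measurable_funepos mf) (fun y => funepos_ge0 _ y).
have neg := cE _ (measurable_funeneg mf) (fun y => funeneg_ge0 _ y).
rewrite integralE.
transitivity (c%:E * \int[mu]_y (EFin \o f)^\+ y -
    c%:E * \int[mu]_y (EFin \o f)^\- y)%E.
  by congr (_ - _)%E; rewrite -?pos -?neg; apply: eq_integral => y _;
    rewrite ?funeposE ?funenegE.
have pf := integrable_pos_fin_num measurableT intf.
have nf := integrable_neg_fin_num measurableT intf.
move: f0; rewrite [in LHS]integralE -(fineK pf) -(fineK nf) -EFinB => f0.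
by rewrite -!EFinM -EFinB -mulrBr EFinM f0 mule0.
Qed.

End change_of_variables.
End atoms_and_matrices.

(** * The Hausdorff operator on an atomic decomposition *)

Section product_sigma_finite.
Local Open Scope ereal_scope.
Context d1 d2 (T1 : measurableType d1) (T2 : measurableType d2) (R : realType).
Variable m1 : {sigma_finite_measure set T1 -> \bar R}.
Variable m2 : {sigma_finite_measure set T2 -> \bar R}.

Lemma sigma_finite_prod : sigma_finite setT (m1 \x m2).
Proof.
have /sigma_finiteP[F [TF ndF Foo]] := sigma_finiteT m1.
have /sigma_finiteP[G [TG ndG Goo]] := sigma_finiteT m2.
exists (fun k => F k `*` G k).
  rewrite -setXTT TF TG; apply/seteqP; split=> [[x y] [[i _ Fi] [j _ Gj]]|].
    exists (maxn i j) => //; split => /=.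
      have /subsetPset sF := ndF _ _ (leq_maxl i j); exact: sF.
    have /subsetPset sG := ndG _ _ (leq_maxr i j); exact: sG.
  by move=> [x y] [k _ [/= Fk Gk]]; split; exists k.
move=> k; have [mF Fk] := Foo k; have [mG Gk] := Goo k.
split; first exact: measurableX.
by rewrite product_measure1E// lte_mul_pinfty// ge0_fin_numE.
Qed.

Definition product_sigma_finite :
  {sigma_finite_measure set (T1 * T2)%type -> \bar R} :=
  sigma_finite_of sigma_finite_prod.

End product_sigma_finite.

Section hausdorff_of_atoms.
Context (R : realType) (K : normedDivisionRingType R) (n : nat).
Local Notation V := 'cV[K]_n.
Local Notation X := (borel V).
Hypotheses (lcK : locally_compact [set: K]) (scK : sigma_compact K).
Variable muK : {measure set (borel K) -> \bar R}.
Hypotheses (haarK : haar_measure K +%R muK) (normK : norm_is_module muK).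
Hypothesis n_gt0 : (0 < n)%N.
Variable mu : {sigma_finite_measure set X -> \bar R}.
Hypothesis hmu : haar_measure V +%R mu.

Variables (A Ainv : V -> 'M[K]_n) (Phi : X -> R) (W : X -> R) (L0 : R).
Hypothesis mA : measurable_fun setT (A : X -> borel 'M[K]_n).
Hypotheses (AAinv : forall u, A u *m Ainv u = 1%:M)
  (AinvA : forall u, Ainv u *m A u = 1%:M).
Hypothesis mPhi : measurable_fun setT Phi.
(* W is the weighted kernel |Phi| k^n, possibly not measurable *)
Hypothesis Phi_W : forall u, `|Phi u| * row_sum_norm (Ainv u) ^+ n <= W u.
Hypothesis W_L0 : (\int[mu]_u (W u)%:E <= L0%:E)%E.

Variables (lam : nat -> R) (b : nat -> X -> R) (s r : nat -> R) (x : nat -> V)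
  (S : R).
Hypothesis lam_S : (\sum_(0 <= j <oo) `|lam j|%:E <= S%:E)%E.
Hypothesis r_gt0 : forall j, 0 < r j.
Hypothesis mb : forall j, measurable_fun setT (b j).
Hypothesis b_le : forall j y, `|b j y| <= s j.
Hypothesis b_supp : forall j y, b j y != 0 -> rho_ball (x j) (r j) y.
Hypothesis s_ball : forall j, ((s j)%:E * mu (rho_ball (x j) (r j)) <= 1)%E.
Hypothesis b_mean0 : forall j, (\int[mu]_y (b j y)%:E = 0)%E.

Let cnt : {sigma_finite_measure set nat -> \bar R} :=
  sigma_finite_of (sigma_finite_counting R).
Let P := product_sigma_finite mu cnt.

Definition family (p : (X * nat) * X) : R :=
  Phi p.1.1 * (lam p.1.2 * b p.1.2 (A p.1.1 *m (p.2 : V))).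

Let bound (w : X * nat) : R := `|Phi w.1| * (`|lam w.2| * s w.2).
Let vol (w : X * nat) : \bar R :=
  (((2 * row_sum_norm (Ainv w.1)) ^+ n)%:E * mu (rho_ball (x w.2) (r w.2)))%E.

Let s_ge0 j : 0 <= s j. Proof. exact: le_trans (normr_ge0 _) (b_le j point). Qed.
Let k_ge0 u : 0 <= row_sum_norm (Ainv u). Proof. exact: row_sum_norm_ge0. Qed.
Let W_ge0 u : 0 <= W u.
Proof. by apply: le_trans (Phi_W u); rewrite mulr_ge0// exprn_ge0. Qed.
Let S_ge0 : 0 <= S.
Proof.
by rewrite -lee_fin (le_trans _ lam_S)// nneseries_ge0// => k _ _; rewrite lee_fin.
Qed.

Let mfamily : measurable_fun setT family.
Proof.
have [d dd] := sigma_compact_dense scK.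
pose g (p : (X * X) * nat) : R :=
  Phi p.1.1 * (lam p.2 * b p.2 (A p.1.1 *m (p.1.2 : V))).
have mg : measurable_fun setT g.
  apply: measurable_fun_prod_nat => j; rewrite /g /=.
  apply: measurable_funM; first exact: measurableT_comp mPhi measurable_fst.
  apply: measurable_funM; first exact: measurable_cst.
  apply: (measurableT_comp (mb j)).
  apply: (measurable_mulmx dd); last exact: measurable_snd.
  exact: measurableT_comp mA measurable_fst.
rewrite (_ : family = g \o (fun p : (X * nat) * X => ((p.1.1, p.2), p.1.2)))//.
apply: measurableT_comp => //; apply: measurable_fun_pair; last first.
  by apply: measurableT_comp.
apply: measurable_fun_pair; last exact: measurable_snd.
exact: measurableT_comp.
Qed.

Let mbound : measurable_fun setT bound.
Proof.
apply: measurable_fun_prod_nat => j; rewrite /bound /=; apply: measurable_funM.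
  exact: measurableT_comp mPhi.
exact: measurable_cst.
Qed.

Let family_bound w y : `|family (w, y)| <= bound w.
Proof. by rewrite /family /bound !normrM !ler_wpM2l ?normr_ge0//. Qed.

Let family_mean0 w : (\int[mu]_y (family (w, y))%:E = 0)%E.
Proof.
case: w => u j; rewrite /family/=.
have intb : mu.-integrable setT (EFin \o b j).
  apply/integrableP; split; first exact/measurable_EFinP.
  apply: (@le_lt_trans _ _ 1%E); last exact: ltry.
  apply: le_trans (s_ball j).
  have mball := measurable_rho_ball (x j) (r j).
  rewrite (_ : mu _ = \int[mu]_y (\1_(rho_ball (x j) (r j)) y)%:E)%E; last first.
    by rewrite integral_indic// setIT.
  rewrite -ge0_integralZl_EFin//; last first.
    by apply/measurable_EFinP; exact: measurable_indic.
  apply: ge0_le_integral => //.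
  - by apply: measurableT_comp => //; exact/measurable_EFinP.
  - by apply/measurable_EFinP; apply: measurable_funM => //; exact: measurable_indic.
  - move=> y _; rewrite lee_fin /=.
    have [->|by0] := eqVneq (b j y) 0; first by rewrite normr0 mulr_ge0.
    by rewrite indicE mem_set ?mulr1//; exact: b_supp.
have [intM M0] := integral_mulmx_eq0 lcK scK hmu (AAinv u) (AinvA u) intb (b_mean0 j).
under eq_integral do rewrite mulrA EFinM.
by rewrite integralZl// M0 mule0.
Qed.

Let vol_ge0 w : (0 <= vol w)%E.
Proof. by rewrite mule_ge0// lee_fin exprn_ge0// mulr_ge0. Qed.

Let bound_vol_le u j : ((bound (u, j))%:E * vol (u, j) <=
  (2 ^+ n * W u)%:E * `|lam j|%:E)%E.
Proof.
rewrite /bound /vol /= exprMn.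
set k := row_sum_norm _ ^+ n; set m := mu _.
have k0 : 0 <= k by rewrite exprn_ge0.
have m0 : (0 <= m)%E by exact: measure_ge0.
rewrite muleA -EFinM (_ : _ * (2 ^+ n * k) =
  2 ^+ n * (`|Phi u| * k) * `|lam j| * s j); last by ring.
rewrite [X in (X * m)%E]EFinM -muleA -[leRHS]EFinM -[leRHS]mule1.
apply: lee_pmul => //.
all: rewrite ?mule_ge0 ?lee_fin ?mulr_ge0//.
by rewrite ler_wpM2r// ler_wpM2l.
Qed.

Let bound_vol (h : X * nat -> \bar R) : measurable_fun setT h ->
  (forall w, (0 <= h w)%E) -> (forall w, (h w <= (bound w)%:E * vol w)%E) ->
  (\int[P]_w h w <= (2 ^+ n * L0 * S)%:E)%E.
Proof.
move=> mh h0 hle; rewrite fubini_tonelli1//.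
pose C := 2 ^+ n * S.
have C0 : 0 <= C by rewrite mulr_ge0.
pose H u := (\int[cnt]_j h (u, j))%E.
have H_ge0 u : (0 <= H u)%E by exact: integral_ge0.
have mH : measurable_fun setT H by exact: measurable_fun_fubini_tonelli_F.
have HW u : (H u <= C%:E * (W u)%:E)%E.
  rewrite /H (ge0_integral_count (a := fun j => h (u, j)))//.
  apply: (@le_trans _ _ (\sum_(0 <= j <oo) ((2 ^+ n * W u)%:E * `|lam j|%:E))%E).
    by apply: lee_nneseries => // j _; apply: le_trans (hle _) (bound_vol_le u j).
  rewrite nneseriesZl//.
  rewrite (_ : C%:E * (W u)%:E = (2 ^+ n * W u)%:E * S%:E)%E; last first.
    by rewrite -!EFinM; congr _%:E; rewrite /C; ring.
  by rewrite lee_wpmul2l// lee_fin mulr_ge0.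
rewrite (_ : (2 ^+ n * L0 * S)%:E = C%:E * L0%:E)%E; last first.
  by rewrite -EFinM; congr _%:E; rewrite /C; ring.
have [C_eq0|C_neq0] := eqVneq C 0.
  rewrite integral0_eq ?C_eq0 ?mul0e// => u _; apply/eqP.
  by rewrite eq_le H_ge0 andbT (le_trans (HW u))// C_eq0 mul0e.
have C_gt0 : 0 < C by rewrite lt_neqAle eq_sym C_neq0.
rewrite -lee_pdivrMl// -ge0_integralZl_EFin//; last 2 first.
- by move=> u _; exact: H_ge0.
- by rewrite invr_ge0.
apply: le_trans W_L0; apply: le_lower_integral => u.
  by apply: mule_ge0; [rewrite lee_fin invr_ge0|exact: H_ge0].
by rewrite lee_pdivrMl//; exact: HW.
Qed.

(** By the choice of the dominating scalar, family (w, .) is carried by a ball of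
    measure at most vol w, and the integral of bound * vol over all w = (u, j) is
    at most 2^n times the weighted norm of Phi times the sum of the |lam j|. *)
Lemma hausdorff_atoms (q : R) : 1 < q ->
  exists (lam' : nat -> R) (b' : nat -> V -> R),
  [/\ forall m, 0 <= lam' m,
      (\sum_(0 <= m <oo) (lam' m)%:E <= (q * q * (2 ^+ n * L0 * S))%:E)%E,
      forall m, atom mu (b' m) &
      \forall y \ae mu, P.-integrable setT (fun w => (family (w, y))%:E) /\
        series (fun m => lam' m * b' m y) @ \oo -->
          fine (\int[P]_w (family (w, y))%:E)%E].
Proof.
move=> q1; have [z [t [t0 balls]]] := countable_balls lcK scK hmu haarK normK.
pose B m := rho_ball (z m) (t m).
have B_gt0 m : (0 < mu (B m))%E by exact: haar_rho_ball_gt0.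
have mB m : measurable (B m : set X) by exact: measurable_rho_ball.
have supp w : exists2 m, (forall y, family (w, y) != 0 -> B m y) &
    (mu (B m) <= q%:E * vol w)%E.
  case: w => u j.
  have [y [e [e0 sub vole]]] := mulmx_preimage_rho_ball lcK scK hmu haarK normK
    n_gt0 (x j) (r_gt0 j) (AAinv u) (AinvA u).
  have [m ym volm] := balls y e q e0 q1; exists m.
    move=> v; rewrite /family/= !mulf_eq0 !negb_or => /andP[_ /andP[_ bv]].
    by apply/ym/sub; exact: b_supp bv.
  by rewrite (le_trans volm)// lee_wpmul2l// lee_fin (le_trans ler01)// ltW.
have [lam' [b' [lam'0 lam'S atoms cvg]]] := @averages_of_atoms _ _ _ _ _ P mu B mB
  B_gt0 family bound vol (2 ^+ n * L0 * S) q mfamily mbound family_bound q1 supp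
  family_mean0 vol_ge0 bound_vol.
exists lam', b'; split=> // m; have [mb' b'_supp b'_le b'0] := atoms m.
split=> //; exists (z m), (t m); split=> //; split=> //.
rewrite unlock; case: ifPn => _; last by rewrite inve_ge0; exact: measure_ge0.
by apply/ess_sup_inf.ess_supP; apply: aeW => y; exact: b'_le.
Qed.

Variables (Phi0 : V -> R) (A0 : V -> 'M[K]_n) (f : V -> R).
Hypothesis repr : \forall u \ae mu, Phi0 u = Phi u /\ A0 u = A u.
Hypothesis f_sum : \forall y \ae mu, series (fun j => lam j * b j y) @ \oo --> f y.

(* A u pulls null sets back to null sets, so by Fubini A u *m y avoids the
   exceptional set of f for almost all pairs (u, y). *)
Let f_sum_moved : \forall y \ae mu, \forall u \ae mu,
  series (fun j => lam j * b j (A u *m (y : V))) @ \oo --> f (A u *m (y : V)).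
Proof.
have [d dd] := sigma_compact_dense scK.
have [N [mN N0 fN]] := f_sum.
pose E := [set p : X * X | N (A p.1 *m (p.2 : V))].
have mE : measurable E.
  have mAy : measurable_fun setT
      (fun p : X * X => (A p.1 *m (p.2 : V)) : X).
    apply: (measurable_mulmx dd); last exact: measurable_snd.
    exact: measurableT_comp mA measurable_fst.
  by have := mAy measurableT N mN; rewrite setTI.
have sections : (\int[mu]_y mu [set u | E (u, y)] = 0)%E.
  rewrite -measure_sections_swap// integral0_eq// => u _.
  exact: (mulmx_null lcK scK hmu (AAinv u) (AinvA u) mN N0).
have mE_ysection : measurable_fun setT (fun y => mu [set u | E (u, y)]).
  rewrite (_ : (fun y => _) = mu \o ysection E); first exact: measurable_fun_ysection.
  by apply/funext => y /=; rewrite ysectionE.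
have : ae_eq mu setT (fun y => mu [set u | E (u, y)]) (cst 0%E).
  apply/(ae_eq_integral_abs mu measurableT mE_ysection).
  rewrite -[RHS]sections; apply: eq_integral => y _.
  by rewrite gee0_abs.
apply: ae_imply => y /(_ I) /= Ey0.
exists [set u | E (u, y)]; split => //.
  by have := measurable_ysection y mE; rewrite ysectionE.
move=> u /= nu; apply: fN => /= fy; exact: nu.
Qed.

(** Integrating family over j first, for fixed u, sums the decomposition of f at
    the point A u *m y. *)
Lemma hausdorff_pointwise : \forall y \ae mu,
  P.-integrable setT (fun w => (family (w, y))%:E) ->
  ae_integrable mu (fun u : X => Phi0 u * f (A0 u *m (y : V))) /\
  hausdorff_operator mu Phi0 A0 f y = fine (\int[P]_w (family (w, y))%:E)%E.
Proof.
apply: ae_imply f_sum_moved => y f_y ig.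
pose G u := (\int[cnt]_j (family ((u, j), y))%:E)%E.
have intG : mu.-integrable setT G by exact: (integrable_fubini_F ig).
have GE : (\int[mu]_u G u = \int[P]_w (family (w, y))%:E)%E.
  exact: (integral12_prod_meas1 ig).
have G_fin : \forall u \ae mu, (fine (G u))%:E = G u.
  have := integrable_ae measurableT intG.
  by apply: ae_imply => u /(_ I) Gu; rewrite fineK.
have pointwise : \forall u \ae mu, Phi0 u * f (A0 u *m (y : V)) = fine (G u).
  apply: ae_imply (ae_and (ae_and repr f_y) (ae_integrable1 ig)).
  move=> u [[[-> ->] fu] igu].
  pose t j := family ((u, j), y).
  have abs_t : (\sum_(0 <= j <oo) `|t j|%:E < +oo)%E.
    have /integrableP[_] := igu.
    by rewrite (ge0_integral_count (a := fun j => `|(t j)%:E|%E)).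
  have Gu : G u = (\sum_(0 <= j <oo) (t j)%:E)%E.
    apply: (integral_count (a := fun j => (t j)%:E)).
    by rewrite /summable -nneseries_esumT.
  rewrite Gu; apply: cvg_unique (cvg_series_abs abs_t) => //.
  rewrite (_ : series t = fun k => Phi u * series
    (fun j => lam j * b j (A u *m (y : V))) k).
    exact: cvgMr.
  by apply/funext => k; rewrite /series/= mulr_sumr.
have int_fine : mu.-integrable setT (EFin \o (fine \o G)).
  have mG := measurable_int _ intG.
  apply: le_integrable intG => //.
    apply/measurable_EFinP; apply: measurableT_comp mG; exact: fine_measurable.
  by move=> u _ /=; case: (G u) => [g||]; rewrite /= ?normr0 ?leey.
split; first by exists (fine \o G).
rewrite /hausdorff_operator /Rintegral -GE; congr fine.
transitivity (\int[mu]_u (fine (G u))%:E)%E; last exact: ae_eq_lower_integral.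
by apply: ae_eq_lower_integral; apply: ae_imply pointwise => u ->.
Qed.

Lemma hausdorff_decomposition (q : R) : 1 < q ->
  (\forall y \ae mu, ae_integrable mu (fun u : X => Phi0 u * f (A0 u *m (y : V)))) /\
  exists lam' b', atomic_decomposition mu lam' b' (hausdorff_operator mu Phi0 A0 f) /\
    (\sum_(0 <= m <oo) `|lam' m|%:E <= (q * q * (2 ^+ n * L0 * S))%:E)%E.
Proof.
move=> q1; have [lam' [b' [lam'0 lam'S atoms cvg]]] := hausdorff_atoms q1.
have both := ae_and hausdorff_pointwise cvg.
have abs_lam' : (\sum_(0 <= m <oo) `|lam' m|%:E <= (q * q * (2 ^+ n * L0 * S))%:E)%E.
  by under eq_eseriesr do rewrite ger0_norm//.
split; first by apply: ae_imply both => y [h [/h[]]].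
exists lam', b'; split=> //; split=> //.
  exact: le_lt_trans abs_lam' (ltry _).
by apply: ae_imply both => y [h [/h[_ ->]]].
Qed.

End hausdorff_of_atoms.

(** * Boundedness on the Hardy space *)

Lemma le_of_square_factor (R : realType) (x : \bar R) (D : R) : 0 <= D ->
  (forall q : R, 1 < q -> (x <= (q * q * D)%:E)%E) -> (x <= D%:E)%E.
Proof.
move=> D0 xq; apply/lee_addgt0Pr => e e0.
pose t := Num.min 1 (e / (3 * D + 3)).
have d0 : 0 < 3 * D + 3 by lra.
have t0 : 0 < t by rewrite lt_min ltr01 divr_gt0.
have t1 : t <= 1 by rewrite ge_min lexx.
have tD : t * (3 * D + 3) <= e by rewrite -ler_pdivlMr// ge_min lexx orbT.
apply: le_trans (xq (1 + t) _) _; first by rewrite ltrDl.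
rewrite -EFinD lee_fin.
have tt : t * t * D <= t * D by rewrite ler_wpM2r// ler_piMr// ltW.
have tD0 : 0 <= t * D by rewrite mulr_ge0// ltW.
lra.
Qed.

Section measurable_modification.
Context (R : realType) (K : normedDivisionRingType R) (n : nat).
Local Notation V := 'cV[K]_n.
Local Notation X := (borel V).
Variable mu : {measure set X -> \bar R}.
Variables (A Ainv : V -> 'M[K]_n) (Phi : V -> R).
Hypothesis mA : ae_measurable mu (A : X -> borel 'M[K]_n).
Hypotheses (AAinv : forall u, A u *m Ainv u = 1%:M)
  (AinvA : forall u, Ainv u *m A u = 1%:M).
Hypothesis mPhi : ae_measurable mu (Phi : X -> R).

(** On an exceptional null set the matrices are replaced by the identity and Phi
    by 0, so that everything is Borel measurable and invertible everywhere. *)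
Lemma ae_modification : exists (A' Ainv' : V -> 'M[K]_n) (Phi' : X -> R),
  [/\ measurable_fun setT (A' : X -> borel 'M[K]_n),
      forall u, A' u *m Ainv' u = 1%:M & forall u, Ainv' u *m A' u = 1%:M] /\
  [/\ measurable_fun setT Phi',
      forall u, `|Phi' u| * row_sum_norm (Ainv' u) ^+ n <=
                `|Phi u| * row_sum_norm (Ainv u) ^+ n &
      \forall u \ae mu, Phi u = Phi' u /\ A u = A' u].
Proof.
have [gA mgA A_gA] := mA; have [p mp Phi_p] := mPhi.
have [N [mN N0 NP]] := ae_and A_gA Phi_p.
have eqN u : ~ N u -> A u = gA u /\ Phi u = p u.
  by move=> nN; apply: contrapT => h; exact/nN/NP.
exists (fun u => if u \in N then 1%:M else gA u).
exists (fun u => if u \in N then 1%:M else Ainv u).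
exists (fun u => p u * \1_(~` N) u); split; split.
- apply: (@measurable_fun_ifT _ _ X (borel 'M[K]_n)) => //.
    apply: (measurable_fun_bool true).
    rewrite [X in measurable X](_ : _ = N)//; apply/seteqP; split => u /=.
      by move=> [_ /set_mem].
    by move=> Nu; split=> //; exact: mem_set.
- move=> u; case: ifPn => [_|]; first by rewrite mul1mx.
  by rewrite notin_setE => /eqN[<- _].
- move=> u; case: ifPn => [_|]; first by rewrite mul1mx.
  by rewrite notin_setE => /eqN[<- _].
- apply: measurable_funM => //.
  exact/measurable_indic/measurableC.
- move=> u; case: ifPn => uN.
    rewrite indicE in_setC uN mulr0 normr0 mul0r mulr_ge0// exprn_ge0//.
    exact: row_sum_norm_ge0.
  rewrite indicE in_setC uN mulr1.
  by move: uN; rewrite notin_setE => /eqN[_ <-].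
- exists N; split => // u /=; apply: contra_notP => nN.
  have [Ag Pp] := eqN _ nN.
  by rewrite indicE mem_set// mulr1 memNset.
Qed.

End measurable_modification.

Theorem corollary3 (R : realType) (K : normedDivisionRingType R)
  (lcK : locally_compact [set: K]) (scK : sigma_compact K)
  (muK : {measure set (borel K) -> \bar R})
  (haarK : haar_measure K +%R muK) (normK : norm_is_module muK)
  (n : nat) (n_ge1 : (1 <= n)%N)
  (mu : {measure set (borel 'cV[K]_n) -> \bar R}) (haar_mu : haar_measure 'cV[K]_n +%R mu)
  (A Ainv : 'cV[K]_n -> 'M[K]_n)
  (mA : ae_measurable mu (A : borel 'cV[K]_n -> borel 'M[K]_n))
  (AAinv : forall u, A u *m Ainv u = 1%:M)
  (AinvA : forall u, Ainv u *m A u = 1%:M)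
  (k := fun u : 'cV[K]_n => row_sum_norm (Ainv u))
  (Phi : 'cV[K]_n -> R)
  (Phi_loc : locally_integrable_on_vectors mu Phi)
  (Phi_L1 : (weighted_L1_norm mu k Phi < +oo)%E) :
  [/\ forall f, hardy1 mu f -> \forall x \ae mu,
        ae_integrable mu (fun u : borel 'cV[K]_n => Phi u * f (A u *m (x : 'cV[K]_n))),
      hardy1_bounded mu (hausdorff_operator mu Phi A) &
      (hardy1_opnorm mu (hausdorff_operator mu Phi A) <=
         (2 ^+ n)%:E * weighted_L1_norm mu k Phi)%E].
Proof.
have [m em] := ex_sigma_finite_measure (haarV_sigma_finite lcK scK haar_mu).
subst mu.
set T := hausdorff_operator _ _ _.
have W_ge0 u : 0 <= `|Phi u| * k u ^+ n.
  by rewrite mulr_ge0// exprn_ge0// row_sum_norm_ge0.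
have L_ge0 : (0 <= weighted_L1_norm m k Phi)%E.
  by apply: integral_ge0 => u _; rewrite lee_fin.
have L_fin : weighted_L1_norm m k Phi \is a fin_num by rewrite ge0_fin_numE.
pose C := 2 ^+ n * fine (weighted_L1_norm m k Phi).
have CE : ((2 ^+ n)%:E * weighted_L1_norm m k Phi)%E = C%:E.
  by rewrite -{1}(fineK L_fin) -EFinM.
have C0 : 0 <= C by rewrite mulr_ge0// fine_ge0.
have [A' [Ainv' [Phi' [[mA' AA' A'A] [mPhi' Phi_W repr]]]]] :=
  ae_modification mA AAinv AinvA Phi_loc.1.
have main f lam a : atomic_decomposition m lam a f ->
  forall q : R, 1 < q ->
  (\forall x \ae m, ae_integrable m
     (fun u : borel 'cV[K]_n => Phi u * f (A u *m (x : 'cV[K]_n)))) /\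
  exists lam' b', atomic_decomposition m lam' b' (T f) /\
    (\sum_(0 <= j <oo) `|lam' j|%:E <=
      (q * q * (C * fine (\sum_(0 <= j <oo) `|lam j|%:E)))%:E)%E.
  move=> [atoms lam_oo f_sum] q q1.
  have S_fin : (\sum_(0 <= j <oo) `|lam j|%:E)%E \is a fin_num.
    by rewrite ge0_fin_numE// nneseries_ge0// => j _ _; rewrite lee_fin.
  pose rep j (t : (borel 'cV[K]_n -> R) * R * 'cV[K]_n * R) :=
    [/\ 0 < t.2, measurable_fun setT t.1.1.1 & \forall y \ae m, t.1.1.1 y = a j y] /\
    [/\ forall y, `|t.1.1.1 y| <= t.1.1.2,
        forall y, t.1.1.1 y != 0 -> rho_ball t.1.2 t.2 y,
        (t.1.1.2%:E * m (rho_ball t.1.2 t.2) <= 1)%E &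
        (\int[m]_y (t.1.1.1 y)%:E = 0)%E].
  have /choice[F FP] j : exists t, rep j t.
    have [b [s [x [r h]]]] := atom_representative haar_mu (atoms j).
    by exists (b, s, x, r).
  pose b j := (F j).1.1.1.
  have eq_b : \forall y \ae m, forall j, b j y = a j y.
    by apply: ae_foralln => j; have [[_ _ h] _] := FP j.
  have b_sum : \forall y \ae m, series (fun j => lam j * b j y) @ \oo --> f y.
    apply: ae_imply (ae_and eq_b f_sum) => y [ba].
    by rewrite (_ : (fun j => lam j * b j y) = (fun j => lam j * a j y))//;
      apply/funext => j; rewrite ba.
  have := @hausdorff_decomposition R K n lcK scK muK haarK normK n_ge1 m haar_mu
    A' Ainv' Phi' (fun u => `|Phi u| * k u ^+ n)
    (fine (weighted_L1_norm m k Phi)) mA' AA' A'A mPhi' Phi_W _ lam b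
    (fun j => (F j).1.1.2) (fun j => (F j).2) (fun j => (F j).1.2)
    (fine (\sum_(0 <= j <oo) `|lam j|%:E)%E) _ _ _ _ _ _ _ Phi A f repr b_sum q q1.
  apply.
  - by rewrite fineK.
  - by rewrite fineK.
  - by move=> j; have [[]] := FP j.
  - by move=> j; have [[]] := FP j.
  - by move=> j; have [_ []] := FP j.
  - by move=> j; have [_ []] := FP j.
  - by move=> j; have [_ []] := FP j.
  - by move=> j; have [_ []] := FP j.
have CB : hardy1_bound m T C.
  split=> // f [lam0 [a0 dec0]].
  have [_ [lam' [b' [dec' _]]]] := main f lam0 a0 dec0 2 ltac:(by rewrite ltr1n).
  split; first by exists lam', b'.
  have norm_le lam a : atomic_decomposition m lam a f ->
      (hardy1_norm m (T f) <= C%:E * \sum_(0 <= j <oo) `|lam j|%:E)%E.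
    move=> dec; have [_ lam_oo _] := dec.
    have S0 : (0 <= \sum_(0 <= j <oo) `|lam j|%:E)%E.
      by rewrite nneseries_ge0// => j _ _; rewrite lee_fin.
    have S_fin : (\sum_(0 <= j <oo) `|lam j|%:E)%E \is a fin_num by rewrite ge0_fin_numE.
    rewrite -(fineK S_fin) -EFinM; apply: le_of_square_factor.
      by rewrite mulr_ge0// fine_ge0.
    move=> q q1; have [_ [l [b [decb lb]]]] := main f lam a dec q q1.
    by apply: le_trans lb; apply: ereal_inf_lbound; exists l, b.
  have [C_eq0|C_neq0] := eqVneq C 0.
    by have := norm_le _ _ dec0; rewrite C_eq0 !mul0e.
  have C_gt0 : 0 < C by rewrite lt_neqAle eq_sym C_neq0.
  rewrite -lee_pdivrMl//; apply/ereal_infP => _ [lam [a [dec ->]]].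
  by rewrite lee_pdivrMl//; exact: norm_le dec.
split.
- move=> f [lam [a dec]].
  by have [] := main f lam a dec 2 ltac:(by rewrite ltr1n).
- by exists C.
- by rewrite CE; apply: ereal_inf_lbound; exists C.
Qed.
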